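(* Let $d\ge 1$, $0<\alpha<1$ and let $K\subset\mathbb{R}^d$ be a compact set with strictly positive Hausdorff dimension. Then the set $$\left\{f\in\mathcal C^\alpha(K)\ ;\ \dim_{\mathcal H}\left(\Gamma_f^K\right)=\min\left(\frac{\dim_{\mathcal H}(K)}{\alpha}\,,\,\dim_{\mathcal H}(K)+1-\alpha\right)\right\}$$ is a prevalent subset of $\mathcal C^\alpha(K)$.
   Context: $\dim_{\mathcal H}$ denotes Hausdorff dimension. For a compact set $K\subset\mathbb{R}^d$ and $0<\alpha<1$, $\mathcal C^\alpha(K)$ is the space of real-valued $\alpha$-Hölder functions on $K$, endowed with the norm $$\Vert f\Vert_\alpha=\sup_{x\in K}|f(x)|+\sup_{(x,y)\in K^2,\ x\ne y}\frac{|f(x)-f(y)|}{\| x-y\|^\alpha}.$$ The graph of a function $f:K\to\mathbb{R}$ is $\Gamma_f^K=\{(x,f(x))\ ;\ x\in K\}\subset\mathbb{R}^{d+1}$. Prevalence: let $E$ be a complete metric vector space. A Borel set $A\subset E$ is called Haar-null if there exists a compactly supported (Borel) probability measure $\mu$ on $E$ such that $\mu(x+A)=0$ for every $x\in E$. An arbitrary subset of $E$ is called Haar-null if it is contained in a Haar-null Borel set. The complement of a Haar-null set is called a prevalent set. *)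

(* Defs.v *)
From HB Require Import structures.
From mathcomp Require Import all_boot all_order all_algebra.
From mathcomp Require Import all_classical all_reals all_analysis.
From mathcomp Require Import ring lra.

Set Implicit Arguments.
Unset Strict Implicit.
Unset Printing Implicit Defensive.

Import Order.TTheory GRing.Theory Num.Theory.
Import numFieldNormedType.Exports.

Local Open Scope classical_set_scope.
Local Open Scope ring_scope.

(* The library norm of 'rV[R]_n is the sup norm; it induces the same topology,
   but distances and diameters below are Euclidean. *)
Definition enorm (R : realType) (n : nat) (v : 'rV[R]_n) : R :=
  Num.sqrt (\sum_(i < n) v ord0 i ^+ 2).

Section hausdorff.
Local Open Scope ereal_scope.
Context {R : realType} {n : nat}.
Implicit Types (A U : set 'rV[R]_n) (s delta : R).

(* 0 is added to the set so that the empty set has diameter 0. *)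
Definition ediam U : \bar R :=
  ereal_sup (0 |` [set (enorm (x - y)%R)%:E | x in U & y in U]).

(* |U|^s; the empty set is treated apart because 0 `^ 0 = 1, so that the
   0-dimensional Hausdorff measure is the counting measure. *)
Definition diam_pow s U : \bar R :=
  if U == set0 then 0 else ediam U `^ s.

Definition hausdorff_premeasure s delta A : \bar R :=
  ereal_inf [set \sum_(0 <= i <oo) diam_pow s (U i) |
    U in [set U : nat -> set 'rV[R]_n |
      A `<=` \bigcup_i U i /\ forall i, ediam (U i) <= delta%:E]].

Definition hausdorff_measure s A : \bar R :=
  ereal_sup [set hausdorff_premeasure s delta A |
    delta in [set delta | (0 < delta)%R]].

Definition hausdorff_dim A : \bar R :=
  ereal_inf [set s%:E | s in [set s | (0 <= s)%R /\ hausdorff_measure s A = 0]].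

End hausdorff.

Definition graph (R : realType) (d : nat) (K : set 'rV[R]_d) (f : K -> R) :
    set 'rV[R]_(d + 1) :=
  [set row_mx (val x) (f x)%:M | x in [set: K]].

Section prevalence.
Context {R : realType}.

Definition borel (E : completeNormedModType R) : measurableType _ :=
  g_sigma_algebraType (@open E).

Context {E : completeNormedModType R}.

Definition haar_null_borel (A : set E) : Prop :=
  measurable (A : set (borel E)) /\
  exists mu : probability (borel E) R,
    (exists2 C : set E, compact C & mu (~` C) = 0%E) /\
    (forall x : E, mu [set x + a | a in A] = 0%E).

Definition haar_null (A : set E) : Prop :=
  exists2 B : set E, haar_null_borel B & A `<=` B.

Definition prevalent (A : set E) : Prop := haar_null (~` A).

End prevalence.

Definition is_holder (R : realType) (d : nat) (alpha : R) (K : set 'rV[R]_d) :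
    {pred K -> R} :=
  [pred f | `[< exists C : R, forall x y : K,
     `|f x - f y| <= C * enorm (val x - val y) `^ alpha >]].

Arguments is_holder {R d} alpha K _ /.

(* Compactness of K and positivity of alpha make every Holder function bounded;
   they are parameters of the type so that it is a normed space. *)
Record holder_space (R : realType) (d : nat) (alpha : R) (K : set 'rV[R]_d)
    (alpha_gt0 : 0 < alpha) (cK : compact K) := HolderFun {
  holder_val :> K -> R;
  holder_valP : holder_val \in is_holder alpha K }.

Section holder_lmod.
Context (R : realType) (d : nat) (alpha : R) (K : set 'rV[R]_d).

Lemma is_holder_submod : submod_closed (is_holder alpha K).
Proof.
split=> [|a f g /asboolP[C hC] /asboolP[D hD]]; apply/asboolP.
  by exists 0 => x y; rewrite (_ : _ - _ = 0) ?normr0 ?mul0r//; exact: subrr.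
exists (`|a| * C + D) => x y.
rewrite (_ : _ - _ = a * (f x - f y) + (g x - g y)); last first.
  by rewrite mulrBr addrACA -opprD.
by rewrite (le_trans (ler_normD _ _))// normrM mulrDl lerD// -mulrA ler_wpM2l.
Qed.

HB.instance Definition _ := GRing.isSubmodClosed.Build R (K -> R)
  (is_holder alpha K) is_holder_submod.

Context (alpha_gt0 : 0 < alpha) (cK : compact K).
Local Notation H := (holder_space alpha_gt0 cK).

HB.instance Definition _ := [isSub for @holder_val R d alpha K alpha_gt0 cK].
HB.instance Definition _ := [Choice of H by <:].
HB.instance Definition _ := [SubChoice_isSubLmodule of H by <:].

End holder_lmod.

(* Everything below equips holder_space with the norm holder_norm and shows that
   it is complete. *)
Lemma enorm_ge0 (R : realType) n (v : 'rV[R]_n) : 0 <= enorm v.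
Proof. exact: sqrtr_ge0. Qed.

Lemma enorm_eq0 (R : realType) n (v : 'rV[R]_n) : enorm v = 0 -> v = 0.
Proof.
move=> /eqP; rewrite sqrtr_eq0 => v0.
have /psumr_eq0P H : forall i : 'I_n, true -> 0 <= v ord0 i ^+ 2.
  by move=> i _; exact: sqr_ge0.
have {}v0 : \sum_(i < n) v ord0 i ^+ 2 = 0.
  by apply/eqP; rewrite eq_le v0 sumr_ge0// => i _; exact: sqr_ge0.
apply/rowP => i; rewrite mxE; apply/eqP; rewrite -sqrf_eq0; apply/eqP.
exact: H.
Qed.

Lemma enorm_le (R : realType) n (v : 'rV[R]_n) (M : R) :
  `|v| <= M -> enorm v <= Num.sqrt (M ^+ 2 *+ n).
Proof.
move=> vM; rewrite ler_wsqrtr// -[X in _ *+ X]card_ord -sumr_const ler_sum// => i _.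
rewrite -real_normK ?num_real// lerXn2r ?nnegrE ?(le_trans _ vM)//.
by rewrite [leRHS]/Num.norm/= mx_normrE (le_bigmax _ _ (ord0, i)).
Qed.

Section holder_norm.
Context (R : realType) (d : nat) (alpha : R) (K : set 'rV[R]_d).
Context (alpha_gt0 : 0 < alpha) (cK : compact K).
Local Notation H := (holder_space alpha_gt0 cK).
Implicit Types f g : H.

Definition holder_norm f : R :=
  sup [set `|f x| | x in [set: K]] +
  sup [set `|f p.1 - f p.2| / enorm (val p.1 - val p.2) `^ alpha |
       p in [set p : K * K | p.1 != p.2]].

Let S1 f := [set `|f x| | x in [set: K]].
Let S2 f := [set `|f p.1 - f p.2| / enorm (val p.1 - val p.2) `^ alpha |
       p in [set p : K * K | p.1 != p.2]].

Let dist_gt0 (x y : K) : x != y -> 0 < enorm (val x - val y) `^ alpha.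
Proof.
move=> xy; rewrite powR_gt0// lt_neqAle enorm_ge0 andbT eq_sym.
by apply: contra xy => /eqP/enorm_eq0/subr0_eq/val_inj ->.
Qed.

Let holderP f : exists C : R, forall x y : K,
  `|f x - f y| <= C * enorm (val x - val y) `^ alpha.
Proof. exact/asboolP/(holder_valP f). Qed.

Let bounded_S1 f : exists M : R, forall x, `|f x| <= M.
Proof.
have [C Cf] := holderP f.
have [[x0]|/forallNP nK] := pselect (exists x : K, True); last first.
  by exists 0 => x; case: (nK x).
have [B [_ KB]] := compact_bounded cK.
have {}KB (x : K) : `|val x| <= B + 1 by apply: KB; rewrite ?ltrDl//; exact/set_mem/valP.
exists (`|f x0| + `|C| * Num.sqrt (((B + 1) + (B + 1)) ^+ 2 *+ d) `^ alpha) => x.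
rewrite -[f x](subrK (f x0)) addrC (le_trans (ler_normD _ _))// lerD2l.
rewrite (le_trans (Cf _ _))// (le_trans (ler_wpM2r _ (ler_norm C))) ?powR_ge0//.
rewrite ler_wpM2l// ge0_ler_powR ?nnegrE ?enorm_ge0 ?sqrtr_ge0 ?(ltW alpha_gt0)//.
by apply: enorm_le; rewrite (le_trans (ler_normB _ _))// lerD.
Qed.

Let ub_S1 f : has_ubound (S1 f).
Proof. by have [M fM] := bounded_S1 f; exists M => _ [x _ <-]. Qed.

Let ub_S2 f : has_ubound (S2 f).
Proof.
have [C Cf] := holderP f; exists C => _ [[x y]/= xy <-].
by rewrite ler_pdivrMr ?dist_gt0.
Qed.

Let sup_ge0 (S : set R) : (forall x, S x -> 0 <= x) -> 0 <= sup S.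
Proof.
move=> S0; have [x|] := pselect (has_sup S); last first.
  by move=> nS; rewrite sup_out.
have [x0 Sx0] := x.1; exact: le_trans (S0 _ Sx0) (ub_le_sup x.2 Sx0).
Qed.

Let sup1_ge f x : `|f x| <= sup (S1 f).
Proof. by apply: ub_le_sup; [exact: ub_S1|exists x]. Qed.

Let sup2_ge f x y :
  `|f x - f y| <= sup (S2 f) * enorm (val x - val y) `^ alpha.
Proof.
have [->|xy] := eqVneq x y.
  rewrite !subrr normr0 mulr_ge0 ?powR_ge0//.
  by apply: sup_ge0 => _ [p _ <-]; rewrite divr_ge0 ?powR_ge0.
rewrite -ler_pdivrMr ?dist_gt0//.
by apply: ub_le_sup; [exact: ub_S2|exists (x, y)].
Qed.

Let sup1_ge0 f : 0 <= sup (S1 f).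
Proof. by apply: sup_ge0 => _ [x _ <-]. Qed.

Let sup2_ge0 f : 0 <= sup (S2 f).
Proof. by apply: sup_ge0 => _ [p _ <-]; rewrite divr_ge0 ?powR_ge0. Qed.

Lemma holder_norm_ge f x : `|f x| <= holder_norm f.
Proof. by rewrite (le_trans (sup1_ge f x))// lerDl sup2_ge0. Qed.

Lemma holder_norm_geB f x y :
  `|f x - f y| <= holder_norm f * enorm (val x - val y) `^ alpha.
Proof.
by rewrite (le_trans (sup2_ge f x y))// ler_wpM2r ?powR_ge0// lerDr sup1_ge0.
Qed.

Let sup_le0 (S : set R) (a : R) : 0 <= a -> ubound S a -> sup S <= a.
Proof.
move=> a0 Sa; have [->|/set0P S0] := eqVneq S set0; first by rewrite sup0.
exact: ge_sup.
Qed.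

Lemma holder_norm_le f (a b : R) : 0 <= a -> 0 <= b ->
  (forall x, `|f x| <= a) ->
  (forall x y, `|f x - f y| <= b * enorm (val x - val y) `^ alpha) ->
  holder_norm f <= a + b.
Proof.
move=> a0 b0 fa fb; apply: lerD; apply: sup_le0 => //.
  by move=> _ [x _ <-].
by move=> _ [[x y]/= xy <-]; rewrite ler_pdivrMr ?dist_gt0.
Qed.

Let holder_normD f g : holder_norm (f + g) <= holder_norm f + holder_norm g.
Proof.
rewrite /holder_norm addrACA.
apply: holder_norm_le; rewrite ?addr_ge0 ?sup1_ge0 ?sup2_ge0//.
  by move=> x; rewrite (le_trans (ler_normD _ _))// lerD ?sup1_ge.
move=> x y; rewrite /= mulrDl opprD addrACA.
by rewrite (le_trans (ler_normD _ _))// lerD ?sup2_ge.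
Qed.

Let holder_normZ_le (l : R) f : holder_norm (l *: f) <= `|l| * holder_norm f.
Proof.
rewrite /holder_norm mulrDr.
apply: holder_norm_le; rewrite ?mulr_ge0 ?sup1_ge0 ?sup2_ge0//.
  by move=> x; rewrite normrM ler_wpM2l ?sup1_ge.
move=> x y; rewrite /= -scalerBr normrM -mulrA.
by rewrite ler_wpM2l ?sup2_ge.
Qed.

Let holder_normr0_eq0 f : holder_norm f = 0 -> f = 0.
Proof.
move=> f0; apply: val_inj; apply/funext => x /=; apply/eqP.
by rewrite -normr_le0 -f0 holder_norm_ge.
Qed.

Let holder_normZ (l : R) f : holder_norm (l *: f) = `|l| * holder_norm f.
Proof.
apply/eqP; rewrite eq_le holder_normZ_le/=.
have [->|l0] := eqVneq l 0.
  by rewrite normr0 mul0r /holder_norm addr_ge0 ?sup1_ge0 ?sup2_ge0.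
rewrite -ler_pdivlMl ?normr_gt0// -normfV.
by rewrite -[in leLHS](scalerK l0 f) holder_normZ_le.
Qed.

HB.instance Definition _ := Lmodule_isNormed.Build R H
  holder_normD holder_normZ holder_normr0_eq0.

Lemma holder_normE f : `|f| = holder_norm f.
Proof. by []. Qed.

Let holder_complete (F : set_system H) : ProperFilter F -> cauchy F -> cvg F.
Proof.
move=> FF Fc0.
have Fc (e : R) : 0 < e ->
    exists f0 : H, F [set f | holder_norm (f0 - f) < e].
  move=> e0; have [f0 Ff0] := (cauchyP F).1 Fc0 e e0; exists f0.
  by move: Ff0; rewrite -ball_normE.
have Fx (x : K) : cvg ((f x : R) @[f --> F]).
  apply/cauchy_cvgP/cauchyP => e e0; have [f0 Ff0] := Fc _ e0.
  exists (f0 x); rewrite -ball_normE; change (F [set f : H | `|f0 x - f x| < e]).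
  apply: filterS Ff0 => f /= f0f.
  exact: le_lt_trans (holder_norm_ge (f0 - f) x) f0f.
pose g (x : K) : R := lim ((f x : R) @[f --> F]).
have gx (x : K) : (f x : R) @[f --> F] --> g x by exact: Fx.
have g1 e f0 : F [set f | holder_norm (f0 - f) < e] ->
    forall x, `|f0 x - g x| <= e.
  move=> Ff0 x.
  apply: (cvgr_to_le (cvg_norm (cvgB (cvg_cst (f0 x)) (gx x)))).
  change (F [set f : H | `|f0 x - f x| <= e]).
  apply: filterS Ff0 => f /= f0f.
  exact: le_trans (holder_norm_ge (f0 - f) x) (ltW f0f).
have g2 e f0 : F [set f | holder_norm (f0 - f) < e] ->
    forall x y, `|(f0 x - g x) - (f0 y - g y)| <=
                e * enorm (val x - val y) `^ alpha.
  move=> Ff0 x y.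
  apply: (cvgr_to_le (cvg_norm (cvgB (cvgB (cvg_cst (f0 x)) (gx x))
                                     (cvgB (cvg_cst (f0 y)) (gx y))))).
  change (F [set f : H | `|(f0 x - f x) - (f0 y - f y)| <=
                         e * enorm (val x - val y) `^ alpha]).
  apply: filterS Ff0 => f /= f0f.
  apply: le_trans (holder_norm_geB (f0 - f) x y) _.
  by rewrite ler_wpM2r ?powR_ge0// ltW.
have gH : g \in is_holder alpha K.
  apply/asboolP; have [f0 Ff0] := Fc _ ltr01.
  exists (holder_norm f0 + 1) => x y.
  have -> : g x - g y = (f0 x - f0 y) - ((f0 x - g x) - (f0 y - g y)) by ring.
  rewrite (le_trans (ler_normB _ _))// mulrDl lerD ?holder_norm_geB//.
  exact: g2.
apply/cvg_ex; exists (HolderFun alpha_gt0 cK gH).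
apply/cvgrPdist_le => e e0; have e4 : 0 < e / 4 by rewrite divr_gt0.
have [f0 Ff0] := Fc _ e4; apply: filterS (Ff0) => f /= f0f.
rewrite -[_ - f](subrKA f0) (le_trans (ler_normD _ _))//.
rewrite distrC !holder_normE.
have f0g : holder_norm (f0 - HolderFun alpha_gt0 cK gH) <= e / 4 + e / 4.
  by apply: holder_norm_le; rewrite ?(ltW e4)//; [exact: g1|exact: g2].
by move: f0g f0f; lra.
Qed.

HB.instance Definition _ := Uniform_isComplete.Build H holder_complete.

End holder_norm.

(* Main.v *)
From HB Require Import structures.
Require Import Defs.
From mathcomp Require Import finmap all_boot all_order all_algebra.
From mathcomp Require Import all_classical all_reals all_analysis.
From mathcomp Require Import ring lra measurable_realfun.
Import Order.TTheory GRing.Theory Num.Theory.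
Import numFieldNormedType.Exports.
Local Open Scope classical_set_scope.
Local Open Scope ring_scope.

(** Write D for the dimension of K and tau for min (D / alpha) (D + 1 - alpha).

The upper bound holds for every f. Above a set of diameter r <= 1 the graph of an
alpha-Holder function fits in one set of diameter O(r^alpha), and also in O(r^(alpha-1))
sets of diameter O(r); applied to economical covers of K these two remarks show that the
dimension of the graph is at most D / alpha and D + 1 - alpha (hausdorff_dim_graph_le).

For the lower bound the probe is finite-dimensional: it is the law of t_1 g_1 + ... +
t_N g_N with independent uniform coefficients t_k in [0, 1], where g = (g_1, ..., g_N)
is an Assouad embedding of the snowflake (K, |x - y|^alpha), that is
max_k |g_k x - g_k y| is comparable with |x - y|^alpha. Each g_k is itself alpha-Holder,
and its coordinates are explicit lacunary trigonometric series (snowflake_embedding). As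
one coefficient is enough to move the increment of the random function, for every f
  P(|(f + sum t_k g_k)(x) - (f + sum t_k g_k)(y)| < r) <= C r / |x - y|^alpha
(probe_small_ball).

Fix s < tau. Frostman's lemma provides measures mu on K with mu(B(x, r)) <= C r^sigma for
some sigma < D; the discrete version used here (discrete_frostman) consists of finitely
supported measures, at finer and finer resolution, with a common constant C. Integrating
the small-ball estimate against mu x mu shows that the s-energy of the image of mu on the
graph of f + sum t_k g_k is bounded on average, uniformly in f and in the resolution
(energy_sum_bound). Hence for almost every t these energies are bounded along a sequence of
resolutions, and by Cauchy-Schwarz and compactness the graph is not null for the
s-dimensional measure (hausdorff_pos_of_energy). The exceptional functions form a Borel set
(null_small_energy), and the union of these sets over the rational s < tau is Haar-null. *)

Set Implicit Arguments.
Unset Strict Implicit.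
Unset Printing Implicit Defensive.

(** * Lacunary series and snowflake embeddings *)

Lemma sum_geo_small (R : realType) (q : R) m n : 0 < q -> q < 1 ->
  \sum_(m <= k < n) q ^+ k <= q ^+ m / (1 - q).
Proof.
move=> q0 q1; have q1' : 0 < 1 - q by rewrite subr_gt0.
case: (leqP m n) => mn; last first.
  by rewrite big_geq ?(ltnW mn)// divr_ge0 ?exprn_ge0 ?ltW.
rewrite ler_pdivlMr// -(subnKC mn).
elim: (n - m)%N => [|k IH]; first by rewrite addn0 big_geq// mul0r exprn_ge0 ?ltW.
have h : (m <= m + k)%N by rewrite leq_addr.
suff : (\sum_(m <= i < m + k) q ^+ i) * (1 - q) = q ^+ m - q ^+ (m + k).
  move=> e; rewrite addnS big_nat_recr//= mulrDl e exprD.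
  by have : 0 <= q ^+ m * q ^+ k * q; [rewrite !mulr_ge0 ?exprn_ge0 ?ltW|lra].
elim: k {IH h} => [|k IH]; first by rewrite addn0 big_geq// mul0r subrr.
by rewrite addnS big_nat_recr ?leq_addr//= mulrDl IH exprSr; ring.
Qed.

Lemma sum_geo_large (R : realType) (q : R) n : 1 < q -> \sum_(0 <= k < n) q ^+ k <= q ^+ n / (q - 1).
Proof.
move=> q1; have q1' : 0 < q - 1 by rewrite subr_gt0.
rewrite ler_pdivlMr//; suff -> : (\sum_(0 <= k < n) q ^+ k) * (q - 1) = q ^+ n - 1 by lra.
elim: n => [|k IH]; first by rewrite big_geq// mul0r expr0 subrr.
by rewrite big_nat_recr//= mulrDl IH exprSr; ring.
Qed.

Section weierstrass.
Context {R : realType}.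
Context (A B : R) (s : R -> R).
Context (A0 : 0 < A) (A1 : A < 1) (AB1 : 1 < A * B).
Context (s_lip : forall x y, `|s x - s y| <= `|x - y|)
  (s_bnd : forall x, `|s x| <= 1).

Definition wterm (x : R) (k : nat) : R := A ^+ k * s (B ^+ k * x).

Definition weierstrass (x : R) : R := lim (series (wterm x) @ \oo).

Lemma cvg_weierstrass x : series (wterm x) @ \oo --> weierstrass x.
Proof.
apply: (@normed_cvg _ R^o); apply: (@series_le_cvg _ _ (geometric 1 A)).
- by move=> n; exact: normr_ge0.
- by move=> n; rewrite /= mul1r exprn_ge0// ltW.
- move=> n; rewrite /geometric/= /wterm normrM mul1r ger0_norm ?exprn_ge0 ?(ltW A0)//.
  by rewrite ler_piMr ?exprn_ge0 ?(ltW A0).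
- by apply: is_cvg_geometric_series; rewrite ger0_norm// ltW.
Qed.

(** At scale B ^- n only the n-th term matters: the slower terms are tamed by the
Lipschitz bound on s, the faster ones by its boundedness, and both families sum
geometrically. When A is small and A * B large the error is negligible. *)
Lemma weierstrass_scale x y n :
  `|weierstrass x - weierstrass y - A ^+ n * (s (B ^+ n * x) - s (B ^+ n * y))| <=
  A ^+ n * (B ^+ n * `|x - y| / (A * B - 1) + 2 * A / (1 - A)).
Proof.
have B0 : 0 < B by rewrite -(pmulr_rgt0 _ A0) (lt_trans ltr01).
pose tn := A ^+ n * (s (B ^+ n * x) - s (B ^+ n * y)).
have cv : (series (wterm x) N - series (wterm y) N - tn) @[N --> \oo] -->
    weierstrass x - weierstrass y - tn.
  by apply: cvgB; [apply: cvgB; exact: cvg_weierstrass|exact: cvg_cst].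
apply: (cvgr_to_le (cvg_norm cv)).
exists n.+1 => // N /= nN.
have -> : series (wterm x) N - series (wterm y) N - tn =
  \sum_(0 <= k < n) (wterm x k - wterm y k)
  + \sum_(n.+1 <= k < N) (wterm x k - wterm y k).
  rewrite /series/= -sumrB (@big_cat_nat _ _ _ n)//=; last exact: ltnW.
  by rewrite [X in _ + X - _](@big_ltn _ _ _ n)//= (_ : wterm x n - wterm y n = tn)
    ?/tn ?mulrBr//; ring.
rewrite (le_trans (ler_normD _ _))// mulrDr lerD//.
  apply: (@le_trans _ _ (\sum_(0 <= k < n) ((A * B) ^+ k * `|x - y|))).
    rewrite (le_trans (ler_norm_sum _ _ _))// ler_sum// => k _.
    rewrite /wterm -mulrBr normrM ger0_norm ?exprn_ge0 ?(ltW A0)// exprMn -mulrA.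
    rewrite ler_wpM2l ?exprn_ge0 ?(ltW A0)// (le_trans (s_lip _ _))//.
    by rewrite -mulrBr normrM ger0_norm ?exprn_ge0 ?(ltW B0).
  rewrite -mulr_suml !mulrA -exprMn mulrAC ler_wpM2r//.
  exact: sum_geo_large.
apply: (@le_trans _ _ (\sum_(n.+1 <= k < N) (2 * A ^+ k))).
  rewrite (le_trans (ler_norm_sum _ _ _))// ler_sum// => k _.
  rewrite /wterm -mulrBr normrM ger0_norm ?exprn_ge0 ?(ltW A0)// mulrC.
  rewrite ler_wpM2r ?exprn_ge0 ?(ltW A0)// (le_trans (ler_normB _ _))//.
  by have := s_bnd (B ^+ k * x); have := s_bnd (B ^+ k * y); lra.
rewrite -mulr_sumr mulrCA -mulrA ler_wpM2l// -[in leRHS]mulrCA mulrA -exprSr.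
exact: sum_geo_small.
Qed.

Lemma weierstrass_bound x : `|weierstrass x| <= (1 - A)^-1.
Proof.
have cv : series (wterm x) N @[N --> \oo] --> weierstrass x.
  exact: cvg_weierstrass.
apply: (cvgr_to_le (cvg_norm cv)).
exists 0%N => // N _; rewrite /series/= (le_trans (ler_norm_sum _ _ _))//.
have := @sum_geo_small _ _ 0 N A0 A1; rewrite expr0 div1r; apply: le_trans.
rewrite ler_sum// => k _.
rewrite /wterm normrM ger0_norm ?exprn_ge0 ?(ltW A0)//.
by rewrite ler_piMr ?exprn_ge0 ?(ltW A0).
Qed.

End weierstrass.

Lemma sin_lipschitz (R : realType) (x y : R) : `|sin x - sin y| <= `|x - y|.
Proof.
wlog xy : x y / x <= y.
  move=> h; have [|/ltW] := leP x y; first exact: h.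
  by rewrite distrC (distrC x); exact: h.
have [|c _] := MVT_segment xy (fun z _ => is_derive_sin z).
  by apply: continuous_subspaceT => z; exact: continuous_sin.
move=> e; rewrite distrC e normrM distrC ler_piMl//; exact: cos_max.
Qed.

Lemma cos_lipschitz (R : realType) (x y : R) : `|cos x - cos y| <= `|x - y|.
Proof.
by rewrite -!sinDpihalf (le_trans (sin_lipschitz _ _))// opprD addrACA subrr addr0.
Qed.

Lemma exists_scale (R : realType) (B r : R) : 1 < B -> 0 < r -> r <= 1 ->
  exists n, B ^+ n * r <= 1 < B ^+ n.+1 * r.
Proof.
move=> B1 r0 r1.
have ex : exists n, 1 < B ^+ n.+1 * r.
  have B0 : 0 < B by exact: lt_trans B1.
  have : B^-1 ^+ n @[n --> \oo] --> 0.
    by apply: cvg_expr; rewrite normfV gtr0_norm// invf_lt1.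
  move=> /cvgrPdist_lt /(_ _ r0)[n _ /(_ n (leqnn _))]; rewrite sub0r normrN => h.
  exists n; rewrite -ltr_pdivrMl ?exprn_gt0// mulr1 exprSr invfM.
  rewrite gtr0_norm ?exprn_gt0 ?invr_gt0// exprVn in h.
  by apply: le_lt_trans h; rewrite ler_piMr ?invr_ge0 ?exprn_ge0 ?invf_le1// ltW.
case: (ex_minnP ex) => n hn hmin; exists n; rewrite hn andbT.
case: n hn hmin => [|n] hn hmin; first by rewrite expr0 mul1r.
by rewrite leNgt; apply/negP => /hmin; rewrite ltnn.
Qed.

(** A single profile can take the same value at two points; the pair (cos, sin) cannot,
because |exp(iu) - exp(iv)|^2 = 2 - 2 cos (u - v) is bounded away from 0 when |u - v|
lies in [1, 2], an interval contained in [1, pi]. *)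
Lemma trig_gap (R : realType) (u v : R) : 1 <= `|u - v| <= 2 ->
  exists b : bool, (1 - cos 1) / 2 <=
    `|(if b then sin else cos) u - (if b then sin else cos) v|.
Proof.
move=> /andP[h1 h2].
have c1 : cos (u - v) <= cos 1.
  rewrite -cos_norm; have [->//|n1] := eqVneq `|u - v| 1.
  rewrite ltW// ltr_cos ?in_itv/= ?normr_ge0 ?ler01 ?(le_trans h2) ?pi_ge2//.
    by rewrite lt_neqAle eq_sym n1.
  by rewrite (le_trans _ (pi_ge2 _))// ler1n.
have e : (sin u - sin v) ^+ 2 + (cos u - cos v) ^+ 2 = 2 - 2 * cos (u - v).
  rewrite cosB; have := cos2Dsin2 u; have := cos2Dsin2 v; nra.
have sq (a b : R) : `|a| <= 1 -> `|b| <= 1 -> (a - b) ^+ 2 <= 2 * `|a - b|.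
  move=> a1 b1; rewrite -real_normK ?num_real// expr2 ler_wpM2r//.
  by rewrite (le_trans (ler_normB _ _))//; lra.
have hs := sq _ _ (sin_max u) (sin_max v).
have hc := sq _ _ (cos_max u) (cos_max v).
have [h|h] := leP ((1 - cos 1) / 2) `|sin u - sin v|; first by exists true.
by exists false => /=; lra.
Qed.

Lemma cos1_lt1 (R : realType) : cos 1 < 1 :> R.
Proof.
by rewrite -[X in _ < X]cos0 ltr_cos ?in_itv/= ?lexx ?ler01 ?pi_ge0//
  (le_trans _ (pi_ge2 _))// ler1n.
Qed.

(** Assouad's embedding of the snowflake (R, |x - y|^al) in a Euclidean space, with explicit
coordinates: the Weierstrass functions of ratio B and amplitude B ^ (- al), for both
profiles sin and cos and for all dilations l = 0, ..., B. Given x and y, some dilation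
brings the increment of a suitable term of the series into [1, 2], where one of the two
profiles sees it. *)
Lemma snowflake_embedding (R : realType) (al : R) : 0 < al -> al < 1 ->
  exists (J : finType) (phi : J -> R -> R) (c C : R),
  [/\ 0 < c, 0 <= C,
    forall j x y, `|phi j x - phi j y| <= C * `|x - y| `^ al &
    forall x y, `|x - y| <= 1 -> exists j, c * `|x - y| `^ al <= `|phi j x - phi j y|].
Proof.
move=> al0 al1.
pose c0 : R := (1 - cos 1) / 2.
have c00 : 0 < c0 by rewrite divr_gt0// subr_gt0 cos1_lt1.
have c01 : c0 <= 1 by have := @cos_geN1 R 1; rewrite /c0; lra.
(* with A <= tau and 1 / tau <= A * B the two error terms are at most 4 * tau each, that is
   half of the gap c0 *)
pose tau : R := c0 / 16.
have tau0 : 0 < tau by rewrite divr_gt0.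
have [B [B1 hA hAB]] : exists B : nat, [/\ (1 < B)%N,
    (B%:R : R) `^ (- al) <= tau & tau^-1 <= (B%:R : R) `^ (1 - al)].
  have pw (a x : R) : 0 < a -> tau^-1 `^ a^-1 <= x -> tau^-1 <= x `^ a.
    move=> a0 h; rewrite -[leLHS]powRr1 ?invr_ge0 ?(ltW tau0)//.
    rewrite -(@mulVf _ a) ?gt_eqF// powRrM.
    by apply: ge0_ler_powR; rewrite ?nnegrE ?powR_ge0 ?(ltW a0) ?(le_trans _ h) ?powR_ge0.
  pose M : R := tau^-1 `^ al^-1 + tau^-1 `^ (1 - al)^-1.
  have M0 : 0 <= M by rewrite addr_ge0 ?powR_ge0.
  have MB := archi_boundP M0.
  exists (Num.bound M).+2; split=> //.
    rewrite powRN invf_ple ?posrE ?powR_gt0// pw//.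
    apply: (@le_trans _ _ M); first by rewrite lerDl powR_ge0.
    by rewrite (le_trans (ltW MB))// ler_nat -addn2 leq_addr.
  rewrite pw ?subr_gt0//.
  apply: (@le_trans _ _ M); first by rewrite lerDr powR_ge0.
  by rewrite (le_trans (ltW MB))// ler_nat -addn2 leq_addr.
pose b : R := B%:R; pose A : R := b `^ (- al).
have b1 : 1 < b by rewrite ltr1n.
have b0 : 0 < b by exact: lt_trans b1.
have A0 : 0 < A by rewrite powR_gt0.
have tau1 : tau <= 16^-1 by rewrite /tau; lra.
have A1 : A < 1 by rewrite (le_lt_trans hA)//; lra.
have ABE : A * b = b `^ (1 - al).
  rewrite -[X in _ * X]powRr1 ?ltW// -powRD 1?addrC//.
  by rewrite (gt_eqF b0) implybT.
have AB16 : 16 <= A * b.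
  by rewrite ABE (le_trans _ hAB)// -[leLHS]invrK lef_pV2 ?posrE.
have AB1 : 1 < A * b by lra.
have AX n : A ^+ n = (b ^- n) `^ al.
  by rewrite -powR_mulrn ?ltW// -powRrM -powR_invn ?ltW// -powRrM mulNr -mulrN mulrC.
pose sc (t : bool) : R -> R := if t then sin else cos.
have sc_lip t x y : `|sc t x - sc t y| <= `|x - y|.
  by case: t; [exact: sin_lipschitz|exact: cos_lipschitz].
have sc_bnd t x : `|sc t x| <= 1 by case: t; [exact: sin_max|exact: cos_max].
pose w t := weierstrass A b (sc t).
have ws t := weierstrass_scale A0 A1 AB1 (sc_lip t) (sc_bnd t).
pose C0 : R := 2 / (1 - A) + A^-1 * (1 + (1 / (A * b - 1) + 2 * A / (1 - A))).
have A1' : 0 < 1 - A by rewrite subr_gt0.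
have AB1' : 0 < A * b - 1 by rewrite subr_gt0.
have p1 : 0 <= 2 / (1 - A) by rewrite divr_ge0// ltW.
have p2 : 0 <= A^-1 * (1 + (1 / (A * b - 1) + 2 * A / (1 - A))).
  by rewrite mulr_ge0 ?invr_ge0 ?(ltW A0)// !addr_ge0// divr_ge0 ?mulr_ge0// ltW.
have C00 : 0 <= C0 by rewrite addr_ge0.
have wC t x y : `|w t x - w t y| <= C0 * `|x - y| `^ al.
  have [e|xy] := eqVneq x y.
    by rewrite e !subrr normr0 mulr_ge0// powR_ge0.
  have xy0 : 0 < `|x - y| by rewrite normr_gt0 subr_eq0.
  have [xy1|xy1] := leP `|x - y| 1; last first.
    apply: (@le_trans _ _ (2 / (1 - A))).
      have := weierstrass_bound b A0 A1 (sc_bnd t) x.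
      have := weierstrass_bound b A0 A1 (sc_bnd t) y.
      have := ler_normB (w t x) (w t y); rewrite -/(w t); lra.
    apply: (@le_trans _ _ C0); first by rewrite lerDl.
    rewrite ler_peMr//; have {1}<- : 1 `^ al = 1 :> R by rewrite powR1.
    by apply: ge0_ler_powR; rewrite ?nnegrE ?(ltW al0) ?(ltW xy1).
  have [n /andP[n1 n2]] := exists_scale b1 xy0 xy1.
  apply: (@le_trans _ _ (A^-1 * (1 + (1 / (A * b - 1) + 2 * A / (1 - A))) * `|x - y| `^ al)); last first.
    by rewrite ler_wpM2r ?powR_ge0// lerDr.
  apply: (@le_trans _ _ (A ^+ n * (1 + (1 / (A * b - 1) + 2 * A / (1 - A))))).
    rewrite -(subrK (A ^+ n * (sc t (b ^+ n * x) - sc t (b ^+ n * y))) (w t x - w t y)).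
    rewrite (le_trans (ler_normD _ _))// [leRHS]mulrDr [leRHS]addrC lerD//; last first.
      rewrite normrM ger0_norm ?exprn_ge0 ?(ltW A0)// ler_wpM2l ?exprn_ge0 ?(ltW A0)//.
      rewrite (le_trans (sc_lip _ _ _))// -mulrBr normrM ger0_norm ?exprn_ge0 ?(ltW b0)//.
    rewrite (le_trans (ws _ _ _ _))// ler_wpM2l ?exprn_ge0 ?(ltW A0)// lerD2r.
    by rewrite ler_wpM2r ?invr_ge0 ?(ltW AB1').
  rewrite [leRHS]mulrAC ler_wpM2r//; first by rewrite !addr_ge0// divr_ge0 ?mulr_ge0// ltW.
  rewrite -ler_pdivrMl ?invr_gt0// invrK -exprS AX.
  apply: ge0_ler_powR; rewrite ?nnegrE ?(ltW al0) ?invr_ge0 ?exprn_ge0 ?(ltW b0)//.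
  by rewrite -[leLHS]mulr1 ler_pdivrMl ?exprn_gt0// ltW.
exists ('I_B.+1 * bool)%type, (fun (j : 'I_B.+1 * bool) x => w j.2 ((j.1 : nat)%:R * x)), (c0 / 2), (C0 * b `^ al).
split.
- by rewrite divr_gt0.
- by rewrite mulr_ge0 ?powR_ge0.
- move=> [l t] x y /=; rewrite (le_trans (wC _ _ _))// -mulrA ler_wpM2l//.
  rewrite -mulrBr normrM powRM// ler_wpM2r ?powR_ge0//.
  apply: ge0_ler_powR; rewrite ?nnegrE ?(ltW al0) ?(ltW b0)//.
  by rewrite normr_nat ler_nat -ltnS.
- move=> x y xy1; have [e|xy] := eqVneq x y.
    by exists (ord0, true); rewrite e !subrr normr0 powR0 ?mulr0 ?gt_eqF.
  have xy0 : 0 < `|x - y| by rewrite normr_gt0 subr_eq0.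
  have [n /andP[n1 n2]] := exists_scale b1 xy0 xy1.
  set r := b ^+ n * `|x - y| in n1.
  have r0 : 0 < r by rewrite mulr_gt0 ?exprn_gt0.
  (* r <= 1, so the least integer l above 1 / r satisfies 1 <= l * r <= 1 + r <= 2 *)
  pose l := (Num.truncn r^-1).+1.
  have /andP[l1 l2] : (Num.truncn r^-1)%:R <= r^-1 < l%:R.
    by apply: truncn_itv; rewrite invr_ge0 ltW.
  have lB : (l < B.+1)%N.
    rewrite ltnS /l -(@ltr_nat R) (le_lt_trans l1)//.
    by rewrite -[ltLHS]mulr1 ltr_pdivrMl// mulrC -/b mulrA -exprS.
  have lr : 1 <= l%:R * r <= 2.
    apply/andP; split; first by rewrite -ler_pdivrMr// div1r ltW.
    rewrite /l -natr1 mulrDl mul1r -(ler_pM2r r0) mulVf ?gt_eqF// in l1 *.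
    by lra.
  have [t ht] : exists t, c0 <= `|sc t (b ^+ n * (l%:R * x)) - sc t (b ^+ n * (l%:R * y))|.
    apply: trig_gap; rewrite -!mulrBr mulrCA normrM normr_nat normrM.
    by rewrite (ger0_norm (exprn_ge0 _ (ltW b0))).
  exists (Ordinal lB, t) => /=.
  have := ws t (l%:R * x) (l%:R * y) n; rewrite -/(w t).
  set D := w t _ - w t _ => hD.
  set E := sc t _ - sc t _ in ht hD.
  have hE : A ^+ n * c0 <= `|A ^+ n * E|.
    by rewrite normrM ger0_norm ?exprn_ge0 ?(ltW A0)// ler_wpM2l ?exprn_ge0 ?(ltW A0).
  have hF : A ^+ n * (b ^+ n * `|l%:R * x - l%:R * y| / (A * b - 1) + 2 * A / (1 - A))
      <= A ^+ n * (c0 / 2).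
    rewrite ler_wpM2l ?exprn_ge0 ?(ltW A0)//.
    rewrite -mulrBr normrM normr_nat mulrCA -/r.
    have f1 : l%:R * r / (A * b - 1) <= 4 * tau.
      have : l%:R * r / (A * b - 1) <= 2 / (A * b - 1).
        by rewrite ler_wpM2r ?invr_ge0 ?(ltW AB1')//; case/andP: lr.
      move=> /le_trans; apply; rewrite ler_pdivrMr//.
      have : 1 <= tau * (A * b) by rewrite -ler_pdivrMl// mulr1 ABE.
      by nra.
    have f2 : 2 * A / (1 - A) <= 4 * tau.
      by rewrite ler_pdivrMr//; move: hA tau1; rewrite -/b -/A; nra.
    by move: f1 f2; rewrite /tau; lra.
  have AD : `|x - y| `^ al <= A ^+ n.
    rewrite AX; apply: ge0_ler_powR; rewrite ?nnegrE ?(ltW al0) ?invr_ge0 ?exprn_ge0 ?(ltW b0)//.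
    by rewrite -[leRHS]mulr1 ler_pdivlMl ?exprn_gt0.
  apply: (@le_trans _ _ (A ^+ n * (c0 / 2))).
    by rewrite mulrC ler_wpM2r// divr_ge0// ltW.
  have : `|A ^+ n * E| <= `|D| + `|D - A ^+ n * E|.
    by rewrite -{1}(subKr D (A ^+ n * E)) ler_normB.
  by lra.
Qed.

(** * Uniform random coefficients *)

Section unit_uniform.
Context {R : realType}.

Definition unit_uniform : set (measurableTypeR R) -> \bar R :=
  mrestr lebesgue_measure (measurable_itv `[0, 1]%R).

HB.instance Definition _ := Measure.on unit_uniform.

Let unit_uniform_setT : unit_uniform setT = 1%E.
Proof.
by rewrite /unit_uniform/= /mrestr setTI lebesgue_measure_itv/= lte_fin ltr01 oppr0 adde0.
Qed.

HB.instance Definition _ := Measure_isProbability.Build _ _ _ unit_uniform unit_uniform_setT.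

(** Clipping confines the coefficients to [0, 1] at every sample point, not just almost
surely, so that the law of the random function is carried by a compact set. *)
Definition clip (t : R) : R := Num.max 0 (Num.min 1 t).

Lemma clip_itv t : 0 <= clip t <= 1.
Proof. by rewrite /clip le_max lexx/= ge_max ler01/= ge_min lexx. Qed.

Lemma measurable_clip : measurable_fun setT clip.
Proof. by apply: measurable_maxr => //; exact: measurable_minr. Qed.

Lemma unit_uniform_small_ball (a b c r : R) : 0 < c -> c <= `|b| -> 0 <= r ->
  (unit_uniform [set t | (`|a + b * clip t| < r)%R] <= (2 * r / c)%:E)%E.
Proof.
move=> c0 cb r0; have b0 : 0 < `|b| by exact: lt_le_trans cb.
have bn0 : b != 0 by rewrite -normr_gt0.
apply: (@le_trans _ _ (lebesgue_measure (ball (- a / b) (r / `|b|)))).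
  apply: le_measure; rewrite ?inE.
  - apply: measurableI => //.
    rewrite [X in measurable X](_ : _ = (fun t => `|a + b * clip t|) @^-1` `]-oo, r[); last first.
      by apply/seteqP; split=> t /=; rewrite in_itv.
    rewrite -[X in measurable X]setTI.
    apply: measurableT_comp => //; apply: measurable_funD => //.
    by apply: measurable_funM => //; exact: measurable_clip.
  - exact: measurable_ball.
  - move=> t [/= h]; rewrite in_itv/= => /andP[t0 t1].
    rewrite -ball_normE/= ltr_pdivlMr// -normrM.
    have -> : (- a / b - t) * b = - (a + b * t) by field.
    rewrite normrN; move: h; rewrite /clip (min_idPr _)//.
    by rewrite (max_idPr _).
rewrite lebesgue_measure_ball ?divr_ge0// lee_fin -(mulr_natl (r / _)) mulrA.
by rewrite ler_wpM2l ?mulr_ge0// lef_pV2 ?posrE.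
Qed.

End unit_uniform.

(** N independent uniform coefficients. The product law is built one factor at a time, and
only its coordinates X j and their small-ball estimate are exposed: if b j is large, then
for frozen values of the other coefficients the affine form crosses the window of width
2 * r in a time at most 2 * r / |b j|, whence the bound by Fubini-Tonelli. *)
Lemma cube_probability (R : realType) (N : nat) :
  exists (disp : measure_display) (T : measurableType disp) (P : probability T R)
         (X : 'I_N -> T -> R),
  [/\ forall j, measurable_fun setT (X j),
      forall j t, 0 <= X j t <= 1 &
      forall (a : R) (b : 'I_N -> R) (c r : R), 0 < c -> 0 <= r -> (exists j, c <= `|b j|) ->
        (P [set t | (`|a + \sum_j b j * X j t| < r)%R] <= (2 * r / c)%:E)%E].
Proof.
elim: N => [|N [disp [T [P [X [mX X01 PX]]]]]].
  exists _, unit, (@dirac _ unit tt R : probability unit R), (fun _ _ => 0).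
  by split => [[]//|[]//|a b c r _ _ [[]]].
pose Y (j : 'I_N.+1) (t : measurableTypeR R * T) : R :=
  if unlift ord0 j is Some i then X i t.2 else clip t.1.
have Y0 t : Y ord0 t = clip t.1 by rewrite /Y unlift_none.
have YS i t : Y (lift ord0 i) t = X i t.2 by rewrite /Y liftK.
have mY j : measurable_fun setT (Y j).
  rewrite /Y; case: (unlift ord0 j) => [i|].
    by apply: measurableT_comp; [exact: mX|exact: measurable_snd].
  by apply: measurableT_comp; [exact: measurable_clip|exact: measurable_fst].
exists _, (measurableTypeR R * T)%type, ((@unit_uniform R \x P)%E : probability _ R), Y.
split=> //.
  by move=> j t; rewrite /Y; case: (unlift ord0 j) => [i|]; [exact: X01|exact: clip_itv].
move=> a b c r c0 r0 [j hj].
set A := [set t | _].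
have mA : measurable A.
  rewrite [A](_ : _ = (fun t => `|a + \sum_j b j * Y j t|) @^-1` `]-oo, r[); last first.
    by apply/seteqP; split=> t /=; rewrite in_itv.
  rewrite -[X in measurable X]setTI.
  apply: measurableT_comp => //; apply: measurable_funD => //.
  by apply: measurable_sum => i; apply: measurable_funM.
have YE t : \sum_j b j * Y j t =
    b ord0 * clip t.1 + \sum_(i < N) b (lift ord0 i) * X i t.2.
  by rewrite big_ord_recl Y0; congr (_ + _); apply: eq_bigr => i _; rewrite YS.
have cst (d' : measure_display) (T' : measurableType d') (Q : probability T' R)
    (f : T' -> \bar R) : measurable_fun setT f -> (forall t, 0 <= f t <= (2 * r / c)%:E)%E ->
    (\int[Q]_t f t <= (2 * r / c)%:E)%E.
  move=> mf hf; apply: (@le_trans _ _ (\int[Q]_t (cst (2 * r / c)%:E t))%E).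
    apply: ge0_le_integral => //.
    - by move=> t _; case/andP: (hf t).
    - by move=> t _; case/andP: (hf t).
  by rewrite integral_cst//= probability_setT mule1.
change ((unit_uniform \x P)%E A <= (2 * r / c)%:E)%E.
have [j0|[i ji]] : j = ord0 \/ exists i, j = lift ord0 i.
  by case: (unliftP ord0 j) => [i ->|->]; [right; exists i|left].
- have -> : ((unit_uniform \x P) A = \int[P]_y unit_uniform (ysection A y))%E.
    have := indic_fubini_tonelli unit_uniform P mA.
    by rewrite indic_fubini_tonelli_FE// indic_fubini_tonelli_GE.
  apply: cst; first exact: measurable_fun_ysection.
  move=> y; rewrite measure_ge0/=.
  have := @unit_uniform_small_ball R (a + \sum_(i < N) b (lift ord0 i) * X i y) (b ord0) c r c0.
  rewrite j0 in hj; move=> /(_ hj r0); apply: le_trans.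
  rewrite (_ : ysection A y = [set t | `|a + \sum_(i < N) b (lift ord0 i) * X i y + b ord0 * clip t| < r])//.
  by apply/seteqP; split=> t /=; rewrite /ysection/= inE /A/= YE/=
    (addrC (b ord0 * _)) addrA.
- change (\int[unit_uniform]_x P (xsection A x) <= (2 * r / c)%:E)%E.
  apply: cst; first exact: measurable_fun_xsection.
  move=> x; rewrite measure_ge0/=.
  have := PX (a + b ord0 * clip x) (fun i => b (lift ord0 i)) c r c0 r0.
  move=> /(_ (ex_intro _ i _)); rewrite -ji => /(_ hj); apply: le_trans.
  rewrite [X in (_ X <= _)%E](_ : _ = [set t | `|a + b ord0 * clip x + \sum_(i < N) b (lift ord0 i) * X i t| < r])//.
  by apply/seteqP; split=> t /=; rewrite /xsection/= inE /A/= YE/= addrA.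
Qed.

(** * Null sets of Hausdorff measures *)

Lemma eseries_finite (R : realType) (u : (\bar R)^nat) n :
  (forall i, (n <= i)%N -> u i = 0%E) ->
  (\sum_(0 <= i <oo) u i = \sum_(0 <= i < n) u i)%E.
Proof.
move=> u0; apply: lim_near_cst => //; exists n => // m /= nm.
rewrite (@big_cat_nat _ _ _ n)//= [X in (_ + X)%E](_ : _ = 0%E) ?adde0//.
rewrite big_nat_cond big1//; by move=> i /andP[/andP[/u0]].
Qed.

Section hausdorff_null.
Context {R : realType} {n : nat}.
Implicit Types (A U : set 'rV[R]_n) (s delta r : R).

Lemma ediam_ge0 U : (0 <= ediam U)%E.
Proof. by apply: ereal_sup_ubound; left. Qed.

Lemma ediam_leP U r : 0 <= r ->
  (ediam U <= r%:E)%E <-> (forall x y, U x -> U y -> enorm (x - y) <= r).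
Proof.
move=> r0; split=> [h x y Ux Uy|h].
  rewrite -lee_fin (le_trans _ h)//; apply: ereal_sup_ubound; right.
  by exists x => //; exists y.
apply: ge_ereal_sup => _ [->|[x Ux [y Uy <-]]]; rewrite lee_fin//.
exact: h.
Qed.

Lemma diam_pow_ge0 s U : (0 <= diam_pow s U)%E.
Proof. by rewrite /diam_pow; case: ifP => // _; exact: poweR_ge0. Qed.

Lemma diam_pow_set0 s : diam_pow s (@set0 'rV[R]_n) = 0%E.
Proof. by rewrite /diam_pow eqxx. Qed.

Lemma diam_pow_le s U r : 0 <= s -> 0 <= r -> (ediam U <= r%:E)%E ->
  (diam_pow s U <= (r `^ s)%:E)%E.
Proof.
move=> s0 r0 Ur; rewrite /diam_pow; case: ifP => _; first by rewrite lee_fin powR_ge0.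
rewrite -poweR_EFin; apply: gt0_ler_poweR => //; rewrite in_itv/= ?leey ?andbT ?ediam_ge0//.
Qed.

Lemma hausdorff_premeasure_ge0 s delta A : (0 <= hausdorff_premeasure s delta A)%E.
Proof.
apply: le_ereal_inf_tmp => _ [U _ <-]; apply: nneseries_ge0 => i _ _.
exact: diam_pow_ge0.
Qed.

Lemma hausdorff_null_coverP s A : hausdorff_measure s A = 0%E <->
  forall delta eps : R, 0 < delta -> 0 < eps -> exists U : nat -> set 'rV[R]_n,
    [/\ A `<=` \bigcup_i U i, forall i, (ediam (U i) <= delta%:E)%E &
      (\sum_(0 <= i <oo) diam_pow s (U i) <= eps%:E)%E].
Proof.
split=> [A0 delta eps d0 e0|h].
  have : (hausdorff_premeasure s delta A <= 0)%E.
    by rewrite -A0; apply: ereal_sup_ubound; exists delta.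
  move=> /le_lt_trans /(_ (_ : 0 < eps%:E)%E); rewrite lte_fin => /(_ e0).
  move=> /ereal_inf_lt[_ [U [AU dU] <-] hU]; exists U; split=> //; exact: ltW.
apply/eqP; rewrite eq_le; apply/andP; split.
  apply: ge_ereal_sup => _ [delta /= d0 <-]; apply/lee_addgt0Pr => e e0.
  rewrite add0e; have [U [AU dU hU]] := h _ _ d0 e0.
  by apply: le_trans hU; apply: ereal_inf_lbound; exists U.
apply: (le_trans (hausdorff_premeasure_ge0 s 1 A)).
by apply: ereal_sup_ubound; exists 1 => //=; exact: ltr01.
Qed.

Lemma finite_cover_sum (I : eqType) (l : seq I) (U : I -> set 'rV[R]_n) s delta A :
  0 <= delta ->
  (forall x, A x -> exists2 i, i \in l & U i x) ->
  (forall i, i \in l -> (ediam (U i) <= delta%:E)%E) ->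
  exists V : nat -> set 'rV[R]_n,
    [/\ A `<=` \bigcup_i V i, forall i, (ediam (V i) <= delta%:E)%E &
      (\sum_(0 <= i <oo) diam_pow s (V i) = \sum_(i <- l) diam_pow s (U i))%E].
Proof.
move=> d0 AU dU; exists (nth set0 (map U l)); split.
- move=> x /AU[i il Ux]; exists (index i l) => //=.
  by rewrite (nth_map i) ?index_mem// nth_index.
- move=> k; have [kl|lk] := ltnP k (size (map U l)).
    have /mapP[i il ->] := mem_nth set0 kl; exact: dU.
  by rewrite nth_default//; apply/ediam_leP.
- rewrite (@eseries_finite _ _ (size (map U l))); last first.
    by move=> k lk; rewrite nth_default// diam_pow_set0.
  by rewrite -[in RHS](big_map U xpredT) (big_nth set0).
Qed.

End hausdorff_null.

(** * Saturated weights on nested partitions *)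

Section saturation.
Context {R : realType} (X : finType) (e : nat -> rel X) (w : nat -> R).
Context (e_equiv : forall j, equivalence_rel (e j)).
Context (e_nested : forall j x y, e j.+1 x y -> e j x y).
Context (w_gt0 : forall j, 0 < w j).

Let e_refl j x : e j x x. Proof. by have [] := e_equiv j x x x. Qed.

Let e_eq j x y : e j x y -> e j x =1 e j y.
Proof. by move=> xy z; have [_ /(_ xy)] := e_equiv j x y z. Qed.

Let e_le j k x y : (j <= k)%N -> e k x y -> e j x y.
Proof.
by move=> /subnKC <-; elim: (k - j)%N => [|i IH]; rewrite ?addn0// addnS => /e_nested.
Qed.

Let mass (mu : X -> R) j x := \sum_(y | e j x y) mu y.

Let mass_eq mu j x y : e j x y -> mass mu j x = mass mu j y.
Proof. by move=> xy; apply: eq_bigl; exact: e_eq. Qed.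

Let mass_gt0 mu j x : (forall y, 0 < mu y) -> 0 < mass mu j x.
Proof.
move=> mu0; rewrite /mass (bigD1 x)//=.
by rewrite ltr_pwDl// sumr_ge0// => y _; exact: ltW.
Qed.

Let scale k mu x := mu x * Num.min 1 (w k / mass mu k x).

Let scale_gt0 k mu : (forall y, 0 < mu y) -> forall y, 0 < scale k mu y.
Proof.
by move=> mu0 y; rewrite mulr_gt0// lt_min ltr01/= divr_gt0// mass_gt0.
Qed.

Let mass_scale k mu x : (forall y, 0 < mu y) ->
  mass (scale k mu) k x = Num.min (mass mu k x) (w k).
Proof.
move=> mu0; rewrite /mass /scale.
rewrite (eq_bigr (fun y => mu y * Num.min 1 (w k / mass mu k x))); last first.
  by move=> y xy; rewrite -(mass_eq _ xy).
rewrite -mulr_suml -/(mass mu k x) minr_pMr ?ltW ?mass_gt0// mulr1.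
by rewrite mulrCA mulfV ?mulr1// gt_eqF// mass_gt0.
Qed.

Let saturated n k (mu : X -> R) :=
  [/\ forall x, 0 < mu x,
    forall j x, (k <= j <= n)%N -> mass mu j x <= w j &
    forall x, exists2 j, (k <= j <= n)%N & mass mu j x = w j].

Let saturate n k : (k <= n)%N -> exists mu, saturated n k mu.
Proof.
move=> kn; rewrite -(subKn kn); move: (leq_subr k n).
elim: (n - k)%N => {k kn} [_|i IH ii].
  rewrite subn0; have w0 : forall x : X, 0 < w n by [].
  exists (scale n (fun=> w n)); split; first exact: scale_gt0.
    move=> j x; rewrite -eqn_leq => /eqP <-.
    by rewrite mass_scale// ge_min lexx orbT.
  move=> x; exists n; first by rewrite leqnn.
  rewrite mass_scale//; apply/min_idPr.
  by rewrite /mass (bigD1 x)//= lerDl sumr_ge0// => y _; exact: ltW.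
have [mu [mu0 mule mueq]] := IH (ltnW ii).
have e1 : (n - i = (n - i.+1).+1)%N by rewrite subnSK.
set k := (n - i.+1)%N in e1 *.
have sc_le y : scale k mu y <= mu y.
  by rewrite ler_piMr ?(ltW (mu0 _))// ge_min lexx.
exists (scale k mu); split; first exact: scale_gt0.
  move=> j x /andP[]; rewrite leq_eqVlt => /orP[/eqP <- _|kj jn].
    by rewrite mass_scale// ge_min lexx orbT.
  apply: le_trans (mule j x _); last by rewrite e1 kj.
  by apply: ler_sum.
move=> x; have [le|gt] := leP (w k) (mass mu k x).
  exists k; first by rewrite leqnn leq_subr.
  by rewrite mass_scale//; exact/min_idPr.
have [j /andP[j1 j2] jE] := mueq x.
exists j; first by rewrite j2 andbT (leq_trans _ j1)// e1.
rewrite -jE; apply: eq_bigr => y xy; rewrite /scale.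
have /(mass_eq mu) <- : e k x y by apply: e_le xy; rewrite (leq_trans _ j1)// e1.
by rewrite (min_idPl _) ?mulr1// ler_pdivlMr ?mass_gt0// mul1r ltW.
Qed.

(** Max-flow min-cut on the tree of classes of e, the class of x at level j having capacity
w j. Start from the weight w n at each point and, from the finest level up, scale each
class down to its capacity when it exceeds it. Every point then lies in a class filled
to capacity; the largest such classes are disjoint and cover X. They are listed by their
representatives rep, the class of x in rep being taken at level lev x. *)
Lemma tree_max_flow n : exists (mu : X -> R) (rep : {set X}) (lev : X -> nat),
  [/\ forall x, 0 <= mu x,
    forall j x, (j <= n)%N -> \sum_(y | e j x y) mu y <= w j,
    \sum_x mu x = \sum_(x in rep) w (lev x),
    forall x, (lev x <= n)%N &
    forall y, exists2 x, x \in rep & e (lev x) x y].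
Proof.
have [mu [mu0 mule muex]] := saturate (leq0n n).
have ex x : exists j, (j <= n)%N && (mass mu j x == w j).
  by have [j /andP[_ jn] jE] := muex x; exists j; rewrite jn jE eqxx.
pose lev x := ex_minn (ex x).
have lev_le x : (lev x <= n)%N by rewrite /lev; case: ex_minnP => j /andP[].
have lev_mass x : mass mu (lev x) x = w (lev x).
  by rewrite /lev; case: ex_minnP => j /andP[_ /eqP].
have lev_min x j : (j <= n)%N -> mass mu j x = w j -> (lev x <= j)%N.
  by move=> jn jE; rewrite /lev; case: ex_minnP => i _; apply; rewrite jn jE eqxx.
have lev_eq x y : e (lev x) x y -> lev x = lev y.
  move=> xy; have yx : (lev y <= lev x)%N.
    by apply: lev_min => //; rewrite -(mass_eq _ xy).
  apply/eqP; rewrite eqn_leq yx andbT; apply: lev_min => //.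
  by rewrite (mass_eq _ (e_le yx xy)).
pose E x := e (lev x) x.
have E_eq x y : E x y -> E x =1 E y.
  by move=> xy z; rewrite /E -(lev_eq _ _ xy); exact: e_eq.
pose r x := odflt x [pick y | E x y].
have Er x : E x (r x).
  by rewrite /r; case: pickP => [y//|/(_ x)]; rewrite /E e_refl.
have r_eq x y : E x y -> r x = r y.
  move=> xy; rewrite /r (eq_pick (E_eq _ _ xy)).
  by case: pickP => // /(_ y); rewrite /E e_refl.
exists mu, [set x | r x == x]%SET, lev; split => //.
- by move=> x; exact: ltW.
- rewrite (partition_big r (fun x => x \in [set x | r x == x]%SET))/=; last first.
    by move=> x _; rewrite inE -(r_eq _ _ (Er x)).
  apply: eq_bigr => z; rewrite inE => /eqP rz; rewrite -lev_mass.
  apply: eq_bigl => x; apply/eqP/idP => [<-|].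
    by rewrite -/(E _ _) -(E_eq _ _ (Er x)) /E e_refl.
  by move=> /r_eq <-.
- move=> y; exists (r y); first by rewrite inE -(r_eq _ _ (Er y)).
  by rewrite -/(E _ _) -(E_eq _ _ (Er y)) /E e_refl.
Qed.

End saturation.

(** * Dyadic cells *)

Lemma sum_le_cover (R : realType) (I J : finType) (P : pred I) (Q : J -> pred I) (F : I -> R) :
  (forall i, 0 <= F i) -> (forall i, P i -> exists j, Q j i) ->
  \sum_(i | P i) F i <= \sum_j \sum_(i | Q j i) F i.
Proof.
move=> F0 PQ.
have -> : \sum_j \sum_(i | Q j i) F i = \sum_i \sum_(j | Q j i) F i.
  by rewrite (exchange_big_dep xpredT).
rewrite [leRHS](bigID P)/= -[leLHS]addr0 lerD//; last first.
  by apply: sumr_ge0 => i _; exact: sumr_ge0.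
apply: ler_sum => i /PQ[j Qj]; rewrite (bigD1 j)//= lerDl.
exact: sumr_ge0.
Qed.

Lemma coord_le_norm (R : realType) d (x : 'rV[R]_d) i : `|x ord0 i| <= `|x|.
Proof. by rewrite [leRHS]/Num.norm/= mx_normrE (le_bigmax _ _ (ord0, i)). Qed.

Lemma norm_le_coord (R : realType) d (x : 'rV[R]_d) (M : R) : 0 <= M ->
  (forall i, `|x ord0 i| <= M) -> `|x| <= M.
Proof.
move=> M0 h; rewrite [leLHS]/Num.norm/= mx_normrE; apply: bigmax_le => //.
by move=> [i j] _ /=; rewrite (ord1 i).
Qed.

Section dyadic_cells.
Context {R : realType} {d : nat}.

Definition cell (j : nat) (x : 'rV[R]_d) (i : 'I_d) : int := Num.floor (2 ^+ j * x ord0 i).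

Definition same_cell j x y := [forall i, cell j x i == cell j y i].

Lemma same_cellP j x y : reflect (cell j x =1 cell j y) (same_cell j x y).
Proof. by apply: (iffP forallP) => h i; apply/eqP. Qed.

Lemma same_cell_equiv j : equivalence_rel (same_cell j).
Proof.
move=> x y z; split; first exact/same_cellP.
by move=> /same_cellP h; apply: eq_forallb => i; rewrite h.
Qed.

Lemma same_cell_nested j x y : same_cell j.+1 x y -> same_cell j x y.
Proof.
have half (u v : R) : Num.floor (2 * u) = Num.floor (2 * v) -> Num.floor u <= Num.floor v.
  move=> e; rewrite floor_ge_int.
  have : ((2 * Num.floor u)%:~R : R) <= 2 * v.
    by rewrite -floor_ge_int -e floor_ge_int intrM ler_pM2l// floor_le.
  by rewrite intrM ler_pM2l.
move=> /same_cellP h; apply/same_cellP => i; have := h i.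
rewrite /cell exprS -!mulrA => e; apply/eqP; rewrite eq_le.
by rewrite (half _ _ e) (half _ _ (esym e)).
Qed.

Lemma same_cell_dist j x y : same_cell j x y -> `|x - y| <= 2 ^- j.
Proof.
move=> /same_cellP h; apply: norm_le_coord; first by rewrite invr_ge0 exprn_ge0.
move=> i; have := h i; rewrite /cell !mxE => e.
rewrite -[leRHS]mulr1 ler_pdivlMl ?exprn_gt0// -[X in X * _]gtr0_norm ?exprn_gt0// -normrM.
rewrite mulrBr.
have := floor_itv (2 ^+ j * x ord0 i).
have := floor_itv (2 ^+ j * y ord0 i).
by rewrite e !intrD ler_norml => /andP[? ?] /andP[? ?]; lra.
Qed.

(** A ball of radius one mesh meets at most three mesh intervals per coordinate. *)
Lemma near_cell j (x y : 'rV[R]_d) : `|y - x| < 2 ^- j ->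
  exists e : {ffun 'I_d -> 'I_3}, forall i, cell j y i = cell j x i + (e i : nat)%:Z - 1.
Proof.
move=> xy; exists [ffun i => inord (absz (cell j y i - cell j x i + 1)%R)] => i.
have h : 0 <= cell j y i - cell j x i + 1 < 3.
  rewrite -ltzD1.
  have c : `|2 ^+ j * y ord0 i - 2 ^+ j * x ord0 i| < 1.
    rewrite -mulrBr normrM ger0_norm ?exprn_ge0// -ltr_pdivlMl ?exprn_gt0// mulr1.
    by rewrite (le_lt_trans _ xy)// (le_trans _ (coord_le_norm _ i))// !mxE.
  have := floor_itv (2 ^+ j * x ord0 i).
  have := floor_itv (2 ^+ j * y ord0 i).
  rewrite -!(@ltr_int R) /cell !intrD !intrN.
  move: c; rewrite ltr_norml => /andP[? ?] /andP[? ?] /andP[? ?]; apply/andP; split; lra.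
rewrite ffunE inordK; first by case/andP: h => /gez0_abs -> _; ring.
by case/andP: h => h0; rewrite -{1}(gez0_abs h0).
Qed.

End dyadic_cells.

(** * A discrete Frostman lemma *)

Lemma compact_rV_bounded (R : realType) d (K : set 'rV[R]_d) : compact K ->
  exists2 M : R, 0 < M & forall x, K x -> `|x| <= M.
Proof.
move=> /compact_bounded[B [_ KB]]; exists (Num.max B 0 + 1).
  by rewrite ltr_wpDl// le_max lexx orbT.
by move=> x Kx; apply: KB => //; rewrite ltr_pwDr// le_max lexx.
Qed.

(** A bounded set meets finitely many cells of a given mesh; one point is picked in each. *)
Lemma cell_sample (R : realType) d (K : set 'rV[R]_d) n : compact K -> K !=set0 ->
  exists (X : finType) (pt : X -> 'rV[R]_d),
    (forall x, K (pt x)) /\ forall y, K y -> exists x, same_cell n (pt x) y.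
Proof.
move=> cK [x0 Kx0]; have [M M0 KM] := compact_rV_bounded cK.
(* the cell indices met by K lie in [-L, L]; shifting by L makes them ordinals *)
pose L := (Num.bound (2 ^+ n * M)).+1.
have ML : 2 ^+ n * M + 1 <= L%:R.
  by rewrite -[leRHS]natr1 lerD2r ltW// archi_boundP// mulr_ge0 ?exprn_ge0// ltW.
have cellL y i : K y -> 0 <= cell n y i + L%:Z < (L + L).+1%:Z.
  move=> Ky; have : `|2 ^+ n * y ord0 i| <= 2 ^+ n * M.
    rewrite normrM ger0_norm ?exprn_ge0// ler_wpM2l ?exprn_ge0//.
    by rewrite (le_trans (coord_le_norm _ _))// KM.
  rewrite ler_norml => /andP[h1 h2].
  have /andP[h3 h4] := floor_itv (2 ^+ n * y ord0 i).
  rewrite -ltzD1 -!(@ltr_int R) /cell !intrD in h3 h4 *.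
  rewrite -[(L + L).+1]addn1 !PoszD !intrD.
  rewrite -[(Posz L)%:~R]/(L%:R : R) -[(Posz 1)%:~R]/(1 : R) -[0%:~R]/(0 : R).
  by apply/andP; split; lra.
pose X : finType := {ffun 'I_d -> 'I_(L + L).+1}.
pose G (c : X) := [set x | K x /\ forall i, cell n x i + L%:Z = (c i : nat)%:Z].
exists X, (fun c => xget x0 (G c)); split.
  by move=> c; case: xgetP => [_ -> []|].
move=> y Ky; exists [ffun i => inord (absz (cell n y i + L%:Z)%R)].
case: xgetP => [z _ [Kz hz]|/(_ y)[]].
  apply/same_cellP => i; apply: (addIr L%:Z); rewrite hz ffunE.
  have /andP[h1 h2] := cellL y i Ky.
  rewrite inordK ?gez0_abs// -ltz_nat gez0_abs//.
split=> // i; rewrite ffunE; have /andP[h1 h2] := cellL y i Ky.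
by rewrite inordK ?gez0_abs// -ltz_nat gez0_abs.
Qed.

(** Frostman's lemma at resolution 2 ^- n: a probability mu on finitely many points of K
whose masses satisfy the Frostman condition down to the mesh, with a constant C that is
uniform in n. The saturated cells of tree_max_flow cover K and their sizes to the power s
add up to the total mass, so this mass is bounded below by the content of K, which is
positive as K is not null; it remains to normalize. Working at finite resolution replaces
the weak limit of the classical proof by finite sums. *)
Lemma discrete_frostman (R : realType) d (K : set 'rV[R]_d) (s : R) :
  compact K -> 0 < s -> hausdorff_measure s K <> 0%E ->
  exists2 C : R, 0 < C & forall n : nat,
    exists (X : finType) (pt : X -> 'rV[R]_d) (mu : X -> R),
    [/\ forall x, K (pt x), forall x, 0 <= mu x, \sum_x mu x = 1 &
      forall x j, (j <= n)%N ->
        \sum_(y | `|pt y - pt x| < 2 ^- j) mu y <= C * (2 ^- j) `^ s].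
Proof.
move=> cK s0 Ks.
have [delta [eps [d0 e0 hcov]]] : exists delta eps : R, [/\ 0 < delta, 0 < eps &
    forall U : nat -> set 'rV[R]_d, K `<=` \bigcup_i U i ->
      (forall i, (ediam (U i) <= delta%:E)%E) ->
      (eps%:E < \sum_(0 <= i <oo) diam_pow s (U i))%E].
  apply: contrapT => /forallNP h; apply: Ks; apply/hausdorff_null_coverP => delta eps d0 e0.
  have /forallNP/(_ eps) h1 := h delta.
  apply: contrapT => /forallNP h2; apply: h1; split=> // U KU dU.
  by rewrite ltNge; apply/negP => hU; apply: (h2 U).
have K0 : K !=set0.
  apply/set0P/eqP => K0; have := hcov (fun=> set0).
  rewrite K0 => /(_ (@sub0set _ _)) h.
  have /h : forall i : nat, (ediam (@set0 'rV[R]_d) <= delta%:E)%E.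
    by move=> _; apply/ediam_leP => //; exact: ltW.
  rewrite (@eseries_finite _ _ 0%N) ?big_geq// ?lte_fin ?ltNge ?(ltW e0)//.
  by move=> i _; rewrite diam_pow_set0.
pose M : R := Num.sqrt d%:R + 1.
have M0 : 0 < M by rewrite ltr_wpDl ?sqrtr_ge0.
(* a total mass below c0 would yield a cover by cells of diameter at most M * 2 ^- j, hence
   at most delta, of total size less than eps *)
pose c0 : R := Num.min ((delta / M) `^ s) (eps / M `^ s).
have c00 : 0 < c0 by rewrite lt_min powR_gt0 ?divr_gt0 ?powR_gt0.
exists ((3 ^ d)%:R / c0); first by rewrite divr_gt0// ltr0n expn_gt0.
move=> n; have [X [pt [Kpt ptK]]] := cell_sample n cK K0.
pose e j : rel X := fun x y => same_cell j (pt x) (pt y).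
pose w j : R := (2 ^- j) `^ s.
have w0 j : 0 < w j by rewrite powR_gt0 ?invr_gt0 ?exprn_gt0.
have e_eq j : equivalence_rel (e j) by move=> x y z; exact: same_cell_equiv.
have e_nest j x y : e j.+1 x y -> e j x y by exact: same_cell_nested.
have [mu [rep [lev [mu0 mule musum levn repP]]]] := tree_max_flow e_eq e_nest w0 n.
have mass : c0 <= \sum_x mu x.
  rewrite leNgt; apply/negP => lt.
  have wlt x : x \in rep -> w (lev x) < c0.
    move=> xr; apply: le_lt_trans lt; rewrite musum (bigD1 x)//= lerDl.
    by apply: sumr_ge0 => y _; exact: ltW.
  pose U x := [set y | same_cell (lev x) (pt x) y].
  have dU x : (ediam (U x) <= (M * 2 ^- lev x)%:E)%E.
    apply/ediam_leP; first by rewrite mulr_ge0 ?(ltW M0)// invr_ge0 exprn_ge0.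
    move=> y z Uy Uz; have yz : same_cell (lev x) y z.
      by have [_ /(_ Uy) <-] := same_cell_equiv (lev x) (pt x) y z.
    have := enorm_le (same_cell_dist yz); move=> /le_trans; apply.
    rewrite -mulr_natr sqrtrM ?sqr_ge0// sqrtr_sqr ger0_norm ?invr_ge0 ?exprn_ge0//.
    by rewrite mulrC ler_wpM2r ?invr_ge0 ?exprn_ge0// /M lerDl.
  have [|||V [KV dV VE]] := @finite_cover_sum R d X (enum rep) U s delta K.
  - exact: ltW.
  - move=> y /ptK[x xy]; have [z zr zx] := repP x; exists z; first by rewrite mem_enum.
    rewrite /U/=; have [_ /(_ zx) ->] := same_cell_equiv (lev z) (pt z) (pt x) y.
    have := levn z; move: (lev z) => j jn; rewrite -(subnK jn) in xy.
    by elim: (n - j)%N xy => // k IH; rewrite addSn => /same_cell_nested.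
  - move=> x; rewrite mem_enum => /wlt; rewrite lt_min => /andP[h _].
    apply: (le_trans (dU x)); rewrite lee_fin mulrC -ler_pdivlMr//.
    rewrite leNgt; apply/negP => h'.
    have : (delta / M) `^ s < w (lev x).
      by apply: gt0_ltr_powR => //; rewrite nnegrE ?divr_ge0 ?invr_ge0 ?exprn_ge0 ?ltW.
    by move=> /(lt_trans h); rewrite ltxx.
  have := hcov V KV dV; rewrite VE big_enum/= => /lt_le_trans.
  move=> /(_ (M `^ s * \sum_x mu x)%:E) h.
  have : (eps%:E < (M `^ s * \sum_x mu x)%:E)%E.
    apply: h; rewrite musum mulr_sumr -sumEFin; apply: lee_sum => x _.
    apply: (le_trans (diam_pow_le (ltW s0) _ (dU x))).
      by rewrite mulr_ge0 ?(ltW M0)// invr_ge0 exprn_ge0.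
    by rewrite powRM ?(ltW M0)// invr_ge0 exprn_ge0.
  rewrite lte_fin; move: lt; rewrite lt_min => /andP[_].
  rewrite ltr_pdivlMr ?powR_gt0// mulrC => /lt_trans h' /h'.
  by rewrite ltxx.
set m := \sum_x mu x in mass.
have m0 : 0 < m by exact: lt_le_trans mass.
exists X, pt, (fun x => mu x / m); split => //.
- by move=> x; rewrite divr_ge0// ltW.
- by rewrite -mulr_suml mulfV// gt_eqF.
move=> x j jn; rewrite -mulr_suml.
have ball : \sum_(y | `|pt y - pt x| < 2 ^- j) mu y <= (3 ^ d)%:R * w j.
  pose Q (f : {ffun 'I_d -> 'I_3}) (y : X) :=
    [forall i, cell j (pt y) i == cell j (pt x) i + (f i : nat)%:Z - 1].
  apply: (le_trans (@sum_le_cover R X _ _ Q mu mu0 _)).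
    by move=> y /near_cell[f hf]; exists f; apply/forallP => i; apply/eqP.
  have -> : (3 ^ d)%:R = \sum_(f : {ffun 'I_d -> 'I_3}) 1 :> R.
    by rewrite sumr_const card_ffun !card_ord.
  rewrite mulr_suml; apply: ler_sum => f _; rewrite mul1r.
  have [y0 Qy0|noQ] := pickP (Q f); last by rewrite big_pred0// ltW.
  apply: le_trans (mule j y0 jn).
  rewrite [leRHS](bigID (Q f))/= -[leLHS]addr0 lerD ?sumr_ge0//.
  rewrite le_eqVlt; apply/orP; left; apply/eqP; apply: eq_bigl => y.
  have [Qy|] := boolP (Q f y); last by rewrite andbF.
  rewrite andbT; symmetry; apply/same_cellP => i.
  by rewrite (eqP (forallP Qy i)) (eqP (forallP Qy0 i)).
apply: (@le_trans _ _ ((3 ^ d)%:R * w j / m)).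
  by rewrite ler_wpM2r// invr_ge0 ltW.
rewrite mulrAC ler_wpM2r ?(ltW (w0 _))// ler_wpM2l// lef_pV2 ?posrE//.
Qed.

(** * Upper bound for the dimension of a graph *)

Lemma nneseries_pairing (R : realType) (T : Type) (c : T -> \bar R)
    (G : nat -> nat -> T) : (forall x, 0 <= c x)%E ->
  exists V : nat -> T, [/\ forall i j, exists k, V k = G i j,
    forall k, exists i j, V k = G i j &
    (\sum_(0 <= k <oo) c (V k) = \sum_(0 <= i <oo) \sum_(0 <= j <oo) c (G i j))%E].
Proof.
move=> c0; have /card_esym/ppcard_eqP[f] := card_nat2.
exists (fun k => G (f k).1 (f k).2); split.
- by move=> i j; exists (f^-1%FUN (i, j)); rewrite invK ?inE.
- by move=> k; exists (f k).1, (f k).2.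
- rewrite nneseries_esumT//.
  rewrite (_ : esum _ _ = \esum_(k in setT) c (G k.1 k.2))%E; last first.
    by rewrite (reindex_esum setT setT f).
  rewrite (_ : setT = setT `*`` (fun _ : nat => [set: nat])); last first.
    by apply/seteqP; split=> -[].
  rewrite -(@esum_esum _ _ _ _ _ (fun i j => c (G i j)))//.
  rewrite nneseries_esumT; last by move=> i; exact: nneseries_ge0.
  by apply: eq_esum => i _; rewrite nneseries_esumT.
Qed.

(** Both upper bounds come from replacing each piece U of an economical cover of A by finitely
many sets that cover the part of B above U; p is the projection from B to A. *)
Lemma hausdorff_null_refine (R : realType) n m (A : set 'rV[R]_n) (B : set 'rV[R]_m)
    (p : 'rV[R]_m -> 'rV[R]_n) (s t a C : R) :
  0 < a -> 0 < C -> (forall y, B y -> A (p y)) ->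
  (forall U r, 0 <= r -> r <= 1 -> ediam U = r%:E ->
    exists l : seq (set 'rV[R]_m),
     [/\ forall y, B y -> U (p y) -> exists2 V, V \in l & V y,
         forall V, V \in l -> (ediam V <= (C * r `^ a)%:E)%E &
         (\sum_(V <- l) diam_pow t V <= (C * r `^ s)%:E)%E]) ->
  hausdorff_measure s A = 0%E -> hausdorff_measure t B = 0%E.
Proof.
move=> a0 C0 BA ref /hausdorff_null_coverP nullA; apply/hausdorff_null_coverP.
move=> delta eps d0 e0.
pose d1 := Num.min 1 ((delta / C) `^ a^-1).
have d10 : 0 < d1 by rewrite lt_min ltr01 powR_gt0// divr_gt0.
have [U [AU dU sU]] := nullA d1 (eps / C) d10 (divr_gt0 e0 C0).
have small r : 0 <= r -> r <= d1 -> C * r `^ a <= delta.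
  move=> r0; rewrite le_min => /andP[_ h]; rewrite -ler_pdivlMl// mulrC.
  rewrite -[leRHS]powRr1 ?divr_ge0 ?(ltW d0) ?(ltW C0)// -(@mulVf _ a) ?gt_eqF// powRrM.
  by apply: ge0_ler_powR; rewrite ?nnegrE ?powR_ge0 ?(ltW a0).
have /choice[l hl] : forall i, exists l : seq (set 'rV[R]_m),
     [/\ forall y, B y -> U i (p y) -> exists2 V, V \in l & V y,
         forall V, V \in l -> (ediam V <= delta%:E)%E &
         (\sum_(V <- l) diam_pow t V <= C%:E * diam_pow s (U i))%E].
  move=> i; have [U0|U0] := eqVneq (U i) set0.
    by exists [::]; rewrite U0 diam_pow_set0 mule0 big_nil; split.
  have Ui := dU i; have Ui0 := ediam_ge0 (U i).
  case E : (ediam (U i)) Ui Ui0 => [r| |]//; rewrite !lee_fin => rd r0.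
  have [||l [l1 l2 l3]] := ref (U i) r _ _ E => //.
    by rewrite (le_trans rd)// /d1 ge_min lexx.
  exists l; split=> //.
    by move=> V /l2 /le_trans; apply; rewrite lee_fin small.
  by rewrite /diam_pow (negbTE U0) E poweR_EFin.
have [V [GV VG VE]] := @nneseries_pairing R _ (@diam_pow R m t)
  (fun i => nth set0 (l i)) (@diam_pow_ge0 R m t).
exists V; split.
- move=> y By; have [i _ Ui] := AU _ (BA _ By); have [l1 _ _] := hl i.
  have [W Wl Wy] := l1 _ By Ui; have [k Vk] := GV i (index W (l i)).
  by exists k => //; rewrite Vk nth_index.
- move=> k; have [i [j ->]] := VG k; have [_ l2 _] := hl i.
  have [jl|lj] := ltnP j (size (l i)); first by apply: l2; rewrite mem_nth.
  by rewrite nth_default//; apply/ediam_leP => //; exact: ltW.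
- rewrite VE (@le_trans _ _ (\sum_(0 <= i <oo) (C%:E * diam_pow s (U i)))%E)//.
    apply: lee_nneseries => [i _ _|i _]; first by apply: nneseries_ge0 => ? _ _; exact: diam_pow_ge0.
    have [_ _ l3] := hl i; apply: le_trans l3.
    rewrite (@eseries_finite _ _ (size (l i))); last first.
      by move=> k lk; rewrite nth_default// diam_pow_set0.
    by rewrite (big_nth set0).
  rewrite nneseriesZl//; last by move=> i _; exact: diam_pow_ge0.
  apply: (@le_trans _ _ (C%:E * (eps / C)%:E)%E).
    by rewrite lee_wpmul2l// lee_fin ltW.
  by rewrite -EFinM mulrC divfK// gt_eqF.
Qed.

Lemma enorm_row_mx (R : realType) d (u : 'rV[R]_d) (v : R) :
  enorm (row_mx u (v%:M : 'rV[R]_1)) = Num.sqrt (enorm u ^+ 2 + v ^+ 2).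
Proof.
rewrite /enorm sqr_sqrtr; last by apply: sumr_ge0 => i _; exact: sqr_ge0.
rewrite big_split_ord/= big_ord1 row_mxEr mxE eqxx; congr (Num.sqrt (_ + _)).
by apply: eq_bigr => i _; rewrite row_mxEl.
Qed.

Lemma enorm_row_mx_le (R : realType) d (u : 'rV[R]_d) (v : R) :
  enorm (row_mx u (v%:M : 'rV[R]_1)) <= enorm u + `|v|.
Proof.
have h : 0 <= enorm u + `|v| by rewrite addr_ge0 ?enorm_ge0.
rewrite enorm_row_mx -[leRHS](ger0_norm h) -sqrtr_sqr ler_wsqrtr//.
rewrite sqrrD real_normK ?num_real// lerD2r lerDl mulrn_wge0// mulr_ge0 ?enorm_ge0//.
Qed.

Lemma enorm_row_mx_gel (R : realType) d (u : 'rV[R]_d) (v : R) :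
  enorm u <= enorm (row_mx u (v%:M : 'rV[R]_1)).
Proof.
rewrite enorm_row_mx -[leLHS](ger0_norm (enorm_ge0 u)) -sqrtr_sqr ler_wsqrtr//.
by rewrite lerDl sqr_ge0.
Qed.

Lemma enorm_row_mx_ger (R : realType) d (u : 'rV[R]_d) (v : R) :
  `|v| <= enorm (row_mx u (v%:M : 'rV[R]_1)).
Proof. by rewrite enorm_row_mx -sqrtr_sqr ler_wsqrtr// lerDr sqr_ge0. Qed.

Lemma coord_le_enorm (R : realType) d (x : 'rV[R]_d) i : `|x ord0 i| <= enorm x.
Proof.
rewrite -sqrtr_sqr ler_wsqrtr// (bigD1 i)//= lerDl.
by apply: sumr_ge0 => j _; exact: sqr_ge0.
Qed.

Lemma norm_le_enorm (R : realType) d (x : 'rV[R]_d) : `|x| <= enorm x.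
Proof.
by apply: norm_le_coord; [exact: enorm_ge0|move=> i; exact: coord_le_enorm].
Qed.

Section graph_upper.
Context {R : realType} {d : nat} (alpha : R) (K : set 'rV[R]_d).
Context (f : K -> R) (C : R).
Context (al0 : 0 < alpha) (al1 : alpha < 1) (C0 : 0 <= C).
Context (f_holder : forall x y : K,
  `|f x - f y| <= C * enorm (val x - val y) `^ alpha).

Let proj (y : 'rV[R]_(d + 1)) : 'rV[R]_d := lsubmx y.

Let graph_proj y : graph f y -> K (proj y).
Proof. by move=> [x _ <-]; rewrite /proj row_mxKl; exact/set_mem/valP. Qed.

Let graph_pointB (x y : K) :
  row_mx (val x) (f x)%:M - row_mx (val y) (f y)%:M =
  row_mx (val x - val y) (f x - f y)%:M :> 'rV[R]_(d + 1).
Proof. by rewrite opp_row_mx add_row_mx -!raddfN -raddfD. Qed.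

Let r_le_pow (r : R) : 0 <= r -> r <= 1 -> r <= r `^ alpha.
Proof.
rewrite le_eqVlt => /orP[/eqP <- _|r0 r1]; first exact: powR_ge0.
by apply: ger1_powR; rewrite ?r0//; exact: ltW.
Qed.

Let pow_enorm_le (x y : K) U r : 0 <= r -> ediam U = r%:E -> U (val x) -> U (val y) ->
  enorm (val x - val y) <= r /\ `|f x - f y| <= C * r `^ alpha.
Proof.
move=> r0 Ur Ux Uy; have h : enorm (val x - val y) <= r.
  by apply: ((ediam_leP U r0).1 _) => //; rewrite Ur.
split=> //; rewrite (le_trans (f_holder x y))// ler_wpM2l//.
by apply: ge0_ler_powR; rewrite ?nnegrE ?enorm_ge0 ?(ltW al0).
Qed.

(** The part of the graph above a set of diameter r <= 1 has diameter O(r ^ alpha): one set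
suffices. *)
Lemma hausdorff_null_graph_div (s : R) : 0 <= s ->
  hausdorff_measure s K = 0%E -> hausdorff_measure (s / alpha) (graph f) = 0%E.
Proof.
move=> s0; pose C1 := 1 + C; have C10 : 0 < C1 by rewrite ltr_wpDr.
pose C2 := C1 + C1 `^ (s / alpha); have C20 : 0 < C2 by rewrite ltr_wpDr ?powR_ge0.
apply: (@hausdorff_null_refine _ _ _ K (graph f) proj s _ alpha C2) => //.
move=> U r r0 r1 Ur; pose V := [set y | graph f y /\ U (proj y)].
have dV : (ediam V <= (C1 * r `^ alpha)%:E)%E.
  apply/ediam_leP; first by rewrite mulr_ge0 ?powR_ge0 ?(ltW C10).
  move=> u v [[x _ <-] Ux] [[y _ <-] Uy]; rewrite /proj !row_mxKl in Ux Uy.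
  rewrite graph_pointB (le_trans (enorm_row_mx_le _ _))//.
  have [h1 h2] := pow_enorm_le r0 Ur Ux Uy.
  by rewrite mulrDl mul1r lerD// (le_trans h1)// r_le_pow.
exists [:: V]; split.
- by move=> y gy Uy; exists V; rewrite ?mem_head.
- move=> W; rewrite inE => /eqP ->; apply: (le_trans dV).
  by rewrite lee_fin ler_wpM2r ?powR_ge0// lerDl powR_ge0.
- rewrite big_seq1 (le_trans (diam_pow_le _ _ dV))//.
  + by rewrite divr_ge0// ltW.
  + by rewrite mulr_ge0 ?powR_ge0 ?(ltW C10).
  rewrite lee_fin powRM ?powR_ge0 ?(ltW C10)// -powRrM mulrCA divff ?gt_eqF// mulr1.
  by rewrite ler_wpM2r ?powR_ge0// lerDr ltW.
Qed.

(** The part of the graph above a set of diameter r <= 1 has height O(r ^ alpha); it is cut into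
O(r ^ (alpha - 1)) slices of height r, which cost r ^ (s + 1 - alpha) each. *)
Lemma hausdorff_null_graph_add (s : R) : 0 <= s ->
  hausdorff_measure s K = 0%E -> hausdorff_measure (s + 1 - alpha) (graph f) = 0%E.
Proof.
move=> s0; set t := s + 1 - alpha.
have t0 : 0 < t by rewrite /t -addrA ltr_wpDl// subr_gt0.
pose C2 := 2 + 2 `^ t * (2 * C + 1).
have C20 : 0 < C2 by rewrite ltr_wpDr// mulr_ge0 ?powR_ge0// addr_ge0// mulr_ge0.
apply: (@hausdorff_null_refine _ _ _ K (graph f) proj s _ alpha C2) => //.
move=> U r r0 r1 Ur; pose V := [set y | graph f y /\ U (proj y)].
have [[_ [[x0 _ <-]]]|/forallNP V0] := pselect (V !=set0); last first.
  exists [::]; split => //.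
  - by move=> y gy Uy; case: (V0 y).
  - by rewrite big_nil lee_fin mulr_ge0 ?powR_ge0 ?(ltW C20).
rewrite /proj row_mxKl => Ux0.
pose h (y : K) := f y - f x0 + C * r `^ alpha.
have h0 (y : K) : U (val y) -> 0 <= h y <= 2 * C * r `^ alpha.
  move=> Uy; have [_] := pow_enorm_le r0 Ur Uy Ux0.
  by rewrite /h ler_norml => /andP[? ?]; apply/andP; split; lra.
(* closed slices: when r = 0 the slice 0 alone must still contain the single point *)
pose W (k : nat) := [set (row_mx (val y) (f y)%:M : 'rV[R]_(d + 1)) |
  y in [set y : K | U (val y) /\ k%:R * r <= h y <= k.+1%:R * r]].
have dW k : (ediam (W k) <= (2 * r)%:E)%E.
  apply/ediam_leP; first by rewrite mulr_ge0.
  move=> _ _ [x [Ux hx] <-] [y [Uy hy] <-].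
  rewrite graph_pointB (le_trans (enorm_row_mx_le _ _))//.
  have [h1 _] := pow_enorm_le r0 Ur Ux Uy.
  have h2 : `|f x - f y| <= r.
    have -> : f x - f y = h x - h y by rewrite /h; ring.
    move: hx hy; rewrite -natr1 mulrDl mul1r => /andP[? ?] /andP[? ?].
    by rewrite ler_norml; apply/andP; split; lra.
  by lra.
pose N := (Num.truncn (2 * C * r `^ alpha / r)).+1.
have vr0 : 0 <= 2 * C * r `^ alpha / r by rewrite divr_ge0 ?mulr_ge0 ?powR_ge0.
exists [seq W k | k <- iota 0 N]; split.
- move=> _ [y _ <-]; rewrite row_mxKl => Uy.
  have /andP[hy0 hy1] := h0 y Uy.
  exists (W (Num.truncn (h y / r))); last first.
    exists y => //; split=> //.
    have [re|rn0] := eqVneq r 0.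
      move: hy0 hy1; rewrite re powR0 ?gt_eqF// !mulr0 => h1 h2.
      by rewrite h1 h2.
    have rp : 0 < r by rewrite lt_neqAle eq_sym rn0.
    have /andP[h1 h2] := truncn_itv (divr_ge0 hy0 r0).
    by rewrite -ler_pdivlMr// h1 -ler_pdivrMr// ltW.
  apply: map_f; rewrite mem_iota add0n /N ltnS /=.
  by apply: le_truncn; rewrite ler_wpM2r// invr_ge0.
- move=> _ /mapP[k _ ->]; apply: (le_trans (dW k)); rewrite lee_fin.
  apply: (@le_trans _ _ (2 * r `^ alpha)); first by rewrite ler_wpM2l// r_le_pow.
  rewrite ler_wpM2r ?powR_ge0// lerDl mulr_ge0 ?powR_ge0// addr_ge0// mulr_ge0//.
- rewrite big_map (@le_trans _ _ (\sum_(k <- iota 0 N) ((2 * r) `^ t)%:E)%E)//.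
    apply: lee_sum => k _; apply: diam_pow_le => //; first exact: ltW.
    by rewrite mulr_ge0.
  rewrite sumEFin lee_fin big_const_seq count_predT size_iota iter_addr_0 -[leLHS]mulr_natl.
  rewrite powRM// mulrCA.
  have [re|rn0] := eqVneq r 0.
    by rewrite re (powR0 (lt0r_neq0 t0)) !mulr0 mulr_ge0 ?powR_ge0 ?(ltW C20).
  have rp : 0 < r by rewrite lt_neqAle eq_sym rn0.
  have NE : N%:R <= 2 * C * r `^ alpha / r + 1.
    by rewrite -[N%:R]natr1 lerD2r; case/andP: (truncn_itv vr0).
  have e1 : r `^ alpha / r * r `^ t = r `^ s.
    rewrite -(mulr_powRB1 r0 al0) [r * _ / r]mulrAC divff// mul1r -powRD ?rn0 ?implybT//.
    by congr powR; rewrite /t; ring.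
  have e2 : r `^ t <= r `^ s by apply: ger_powR; rewrite ?rp// /t -addrA lerDl subr_ge0 ltW.
  apply: (@le_trans _ _ (2 `^ t * ((2 * C + 1) * r `^ s))); last first.
    by rewrite mulrA ler_wpM2r ?powR_ge0// lerDr.
  rewrite ler_wpM2l ?powR_ge0//.
  apply: (@le_trans _ _ ((2 * C * r `^ alpha / r + 1) * r `^ t)).
    by rewrite ler_wpM2r ?powR_ge0.
  rewrite mulrDl mul1r [leRHS]mulrDl mul1r lerD//.
  by rewrite -!mulrA [in leLHS](mulrA (r `^ alpha)) e1.
Qed.

Lemma hausdorff_dim_graph_le : (hausdorff_dim (graph f) <=
  Order.min (hausdorff_dim K / alpha%:E)%E (hausdorff_dim K + 1 - alpha%:E)%E)%E.
Proof.
rewrite le_min; apply/andP; split.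
  rewrite inver gt_eqF// lee_pdivlMr//.
  apply: le_ereal_inf_tmp => _ [s [s0 Ks] <-].
  rewrite -lee_pdivlMr//; apply: ereal_inf_lbound.
  exists (s / alpha) => //; split; first by rewrite divr_ge0// ltW.
  exact: hausdorff_null_graph_div.
rewrite -addeA -EFinB -leeBlDr//.
apply: le_ereal_inf_tmp => _ [s [s0 Ks] <-].
rewrite leeBlDr//; apply: ereal_inf_lbound.
exists (s + 1 - alpha); last by rewrite -addrA EFinD.
split; first by rewrite -addrA addr_ge0// subr_ge0 ltW.
exact: hausdorff_null_graph_add.
Qed.

End graph_upper.

(** * Energy and lower bounds for the dimension *)

Lemma exp2_small (R : realType) (s e : R) : 0 < s -> 0 < e ->
  exists n0, forall n, (n0 <= n)%N -> (2 ^- n) `^ s <= e.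
Proof.
move=> s0 e0; have : (2^-1 : R) ^+ n @[n --> \oo] --> 0.
  by apply: cvg_expr; rewrite ger0_norm ?invr_ge0// invf_lt1// ltr1n.
move=> /cvgrPdist_lt /(_ (e `^ s^-1)); rewrite powR_gt0// => /(_ isT)[n0 _ h].
exists n0 => n /h; rewrite sub0r normrN ger0_norm ?exprn_ge0 ?invr_ge0// exprVn => lt.
have -> : e = (e `^ s^-1) `^ s by rewrite -powRrM mulVf ?gt_eqF// powRr1// ltW.
by apply: ge0_ler_powR; rewrite ?nnegrE ?powR_ge0 ?invr_ge0 ?exprn_ge0 ?(ltW s0) ?(ltW lt).
Qed.

Lemma sum_half (R : realType) n : \sum_(i < n) (2 ^- i.+1 : R) <= 1.
Proof.
suff -> : \sum_(i < n) (2 ^- i.+1 : R) = 1 - 2 ^- n.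
  by rewrite gerBl invr_ge0 exprn_ge0.
elim: n => [|n IH]; first by rewrite big_ord0 expr0 invr1 subrr.
by rewrite big_ord_recr/= IH exprS invfM; field.
Qed.

Section energy.
Context {R : realType} {d : nat} {K : set 'rV[R]_d}.

(** The Riesz s-energy of the image of mu on the graph of f, with the kernel of exponent s
replaced by the sum of (2 ^+ k) ^ s over the scales k <= m at which the two points are
close. The truncation at m keeps the diagonal terms finite. *)
Definition energy (X : finType) (pt : X -> K) (mu : X -> R) (s : R) (m : nat)
    (f : K -> R) : R :=
  \sum_x \sum_y \sum_(k < m.+1)
    if (`|val (pt y) - val (pt x)| < 2 ^- k) && (`|f (pt y) - f (pt x)| < 2 ^- k)
    then mu x * mu y * (2 ^+ k) `^ s else 0.

(** If the piece i has mass m_i and size 2 ^- k i, then its pairs of points contribute at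
least m_i ^ 2 * (2 ^+ k i) ^ s to the energy, and Cauchy-Schwarz gives
1 = (sum m_i)^2 <= energy * sum (2 ^- k i) ^ s. *)
Lemma energy_cover (X : finType) (pt : X -> K) (mu : X -> R) (s : R) m (f : K -> R)
    M (N : 'I_M -> set K) (k : 'I_M -> nat) (A : R) : 0 < A ->
  (forall x, 0 <= mu x) -> \sum_x mu x = 1 ->
  (forall x, exists i, N i (pt x)) -> (forall i, (k i <= m)%N) ->
  (forall i x y, N i x -> N i y ->
    `|val y - val x| < 2 ^- k i /\ `|f y - f x| < 2 ^- k i) ->
  energy pt mu s m f <= A -> A^-1 <= \sum_i (2 ^- k i) `^ s.
Proof.
move=> A0 mu0 mu1 /choice[a aN] km NN EA.
pose g i : R := (2 ^+ k i) `^ s.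
have g0 i : 0 < g i by rewrite powR_gt0// exprn_gt0.
have gV i : (2 ^- k i) `^ s = (g i)^-1.
  rewrite -(powR_inv1 (exprn_ge0 _ (ler0n R 2))) -powRrM mulN1r powRN.
  by [].
pose ms i := \sum_(x | a x == i) mu x.
have ms1 : \sum_i ms i = 1 by rewrite -mu1 (partition_big a xpredT).
have E1 : \sum_i g i * ms i ^+ 2 <= A.
  apply: le_trans EA; rewrite /energy (partition_big a xpredT)//=.
  apply: ler_sum => i _; rewrite expr2 /ms mulrCA mulr_suml.
  apply: ler_sum => x /eqP ax; rewrite mulr_sumr mulr_sumr.
  rewrite [leRHS](bigID (fun y => a y == i))/= -[leLHS]addr0.
  have h0 y (j : 'I_m.+1) : 0 <= if (`|val (pt y) - val (pt x)| < 2 ^- j) &&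
      (`|f (pt y) - f (pt x)| < 2 ^- j) then mu x * mu y * (2 ^+ j) `^ s else 0.
    by case: ifP => _; rewrite ?lexx ?(mulr_ge0 (mulr_ge0 (mu0 _) (mu0 _)) (powR_ge0 _ _)).
  apply: lerD; last by apply: sumr_ge0 => y _; apply: sumr_ge0 => j _; exact: h0.
  apply: ler_sum => y /eqP ay.
  have ki : (k i < m.+1)%N by rewrite ltnS.
  rewrite (bigD1 (Ordinal ki))//= ifT; last first.
    have Nx : N i (pt x) by rewrite -ax; exact: aN.
    have Ny : N i (pt y) by rewrite -ay; exact: aN.
    by apply/andP; exact: NN Nx Ny.
  have -> : mu x * (g i * mu y) = mu x * mu y * (2 ^+ k i) `^ s by rewrite /g; ring.
  by rewrite lerDl; apply: sumr_ge0 => j _; exact: h0.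
(* Cauchy-Schwarz in the form 2 * v <= g * v ^ 2 / A + A / g *)
have : 2 * \sum_i ms i <= A^-1 * (\sum_i g i * ms i ^+ 2) + A * \sum_i (g i)^-1.
  rewrite !mulr_sumr -big_split/=; apply: ler_sum => i _.
  have := sqr_ge0 (A^-1 * g i * ms i - 1); have := g0 i; set gi := g i; set v := ms i => gp h.
  have -> : A^-1 * (gi * v ^+ 2) + A / gi = 2 * v + A / gi * (A^-1 * gi * v - 1) ^+ 2.
    by field; rewrite ?gt_eqF.
  by rewrite lerDl mulr_ge0// divr_ge0// ltW.
rewrite ms1; have : A^-1 * (\sum_i g i * ms i ^+ 2) <= 1.
  by rewrite ler_pdivrMl// mulr1.
move=> h1 h2; rewrite (eq_bigr (fun i => (g i)^-1)) => [|i _]; last exact: gV.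
by rewrite -[leLHS]mulr1 ler_pdivrMl//; lra.
Qed.

(** Nullity of the graph would give economical covers by sets U i. Thickening them slightly, so
that each still fits in a dyadic scale, makes them open and compactness leaves finitely
many; at a resolution m finer than all of these scales, energy_cover says that the cover
cannot be economical. *)
Lemma hausdorff_pos_of_energy (s s' A : R) (f : K -> R) : compact K ->
  0 < s -> 0 <= s' -> s' <= s -> 0 < A ->
  (forall eta : R, 0 < eta -> exists2 theta : R, 0 < theta &
    forall x y : K, `|val x - val y| < theta -> `|f x - f y| < eta) ->
  (forall m0, exists m, (m0 <= m)%N /\ exists (X : finType) (pt : X -> K) (mu : X -> R),
    [/\ forall x, 0 <= mu x, \sum_x mu x = 1 & energy pt mu s m f <= A]) ->
  hausdorff_measure s' (graph f) <> 0%E.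
Proof.
move=> cK s0 s'0 s's A0 fuc hE /hausdorff_null_coverP null.
pose eps := A^-1 / (2 * (4 `^ s + 1)).
have s41 : 0 < 4 `^ s + 1 by rewrite ltr_wpDl ?powR_ge0.
have e0 : 0 < eps by rewrite divr_gt0 ?invr_gt0 ?mulr_gt0.
have h20 : 0 < 2^-1 :> R by rewrite invr_gt0.
have [U [gU dU sU]] := null _ _ h20 e0.
(* a dyadic scale into which U i fits with a margin 2 * eta; when diam (U i) = r > 0 the
   scale is less than 4 * r, when r = 0 it is chosen arbitrarily small *)
have /choice[kt hkt] : forall i, exists p : nat * R, let: (k, eta) := p in
    [/\ 0 < eta, forall x y, U i x -> U i y -> enorm (x - y) + 2 * eta <= 2 ^- k &
      (((2 ^- k) `^ s)%:E <= (4 `^ s)%:E * diam_pow s' (U i) + (eps * 2 ^- i.+1)%:E)%E].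
  move=> i; have ei0 : 0 < eps * 2 ^- i.+1 by rewrite mulr_gt0// invr_gt0 exprn_gt0.
  have Ui0 := ediam_ge0 (U i); have Ui := dU i.
  case E : (ediam (U i)) Ui Ui0 => [r| |]//; rewrite !lee_fin => r2 r0.
  have Ur : forall x y, U i x -> U i y -> enorm (x - y) <= r.
    by apply/ediam_leP => //; rewrite E.
  have [re|rn0] := eqVneq r 0.
    have [k /(_ k (leqnn _)) hk] := exp2_small s0 ei0.
    exists (k, 2 ^- k / 2); split.
    - by rewrite divr_gt0 ?invr_gt0 ?exprn_gt0.
    - by move=> x y Ux Uy; have := Ur _ _ Ux Uy; rewrite re; lra.
    - apply: (@le_trans _ _ (eps * 2 ^- i.+1)%:E); first by rewrite lee_fin.
      by rewrite leeDr// mule_ge0 ?lee_fin ?powR_ge0 ?diam_pow_ge0.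
  have rp : 0 < r by rewrite lt_neqAle eq_sym rn0.
  have r1 : r <= 1 by lra.
  have [n /andP[n1 n2]] := exists_scale (ltr1n R 2) rp r1.
  (* one step above the scale of r, to leave room for the margin *)
  case: n n1 n2 => [|n] n1 n2; first by move: n2; rewrite expr1; lra.
  have p0 : 0 < 2 ^+ n :> R by rewrite exprn_gt0.
  have rn : 2 * r <= 2 ^- n by rewrite -[leRHS]mulr1 ler_pdivlMl// mulrA -exprSr.
  have nr : 2 ^- n <= 4 * r.
    rewrite -[leLHS]mulr1 ler_pdivrMl//; move: n2; rewrite 2!exprS => n2.
    by rewrite ltW// (lt_le_trans n2)// le_eqVlt; apply/orP; left; apply/eqP; ring.
  exists (n, r / 2); split.
  - by rewrite divr_gt0.
  - by move=> x y Ux Uy; have := Ur _ _ Ux Uy; lra.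
  have Ui0 : U i != set0.
    apply/eqP => U0; have : (ediam (U i) <= 0%:E)%E by apply/ediam_leP => //; rewrite U0.
    by rewrite E lee_fin leNgt rp.
  rewrite /diam_pow (negbTE Ui0) E poweR_EFin -EFinM -EFinD lee_fin.
  apply: (@le_trans _ _ (4 `^ s * r `^ s')); last by rewrite lerDl ltW.
  apply: (@le_trans _ _ ((4 * r) `^ s)).
    by apply: ge0_ler_powR; rewrite ?nnegrE ?(ltW s0) ?invr_ge0 ?(ltW p0) ?mulr_ge0.
  by rewrite powRM// ler_wpM2l ?powR_ge0//; apply: ger_powR; rewrite ?rp.
pose k i := (kt i).1; pose eta i := (kt i).2.
have hk i : [/\ 0 < eta i, forall x y, U i x -> U i y -> enorm (x - y) + 2 * eta i <= 2 ^- k i &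
      (((2 ^- k i) `^ s)%:E <= (4 `^ s)%:E * diam_pow s' (U i) + (eps * 2 ^- i.+1)%:E)%E].
  by have := hkt i; rewrite /k /eta; case: (kt i).
have /choice[th hth] : forall i, exists theta : R, [/\ 0 < theta, theta <= eta i &
    forall x y : K, `|val x - val y| < theta -> `|f x - f y| < eta i].
  move=> i; have [eta0 _ _] := hk i; have [t t0 ht] := fuc _ eta0.
  exists (Num.min t (eta i)); split.
  - by rewrite lt_min t0.
  - by rewrite ge_min lexx orbT.
  - by move=> x y; rewrite lt_min => /andP[/ht].
pose gp (x : K) : 'rV[R]_(d + 1) := row_mx (val x) (f x)%:M.
(* open sets of the domain instead of the graph: the modulus th i of f makes f vary by less
   than eta i on each ball *)
pose O i : set 'rV[R]_d := \bigcup_(x in [set x : K | U i (gp x)]) ball (val x) (th i).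
have [D _ KD] : finite_subset_cover setT O K.
  move: cK; rewrite compact_cover; apply.
    by move=> i _; apply: bigcup_open => x _; apply: ball_open; have [] := hth i.
  move=> x Kx; pose xK : K := SigSub (mem_set Kx).
  have [i _ Ui] : (\bigcup_i U i) (gp xK) by apply: gU; exists xK.
  by exists i => //; exists xK => //; apply: ballxx; have [] := hth i.
pose M := (\max_(i <- D) i).+1.
have DM i : i \in D -> (i < M)%N by move=> iD; rewrite ltnS (leq_bigmax_seq (F := id)).
pose m0 := \max_(i < M) k i.
have [m [m0m [X [pt [mu [mu0 mu1 EA]]]]]] := hE m0.
have := @energy_cover X pt mu s m f M (fun i => [set x | O i (val x)]) (fun i => k i) A
  A0 mu0 mu1 _ _ _ EA.
move=> /(_ _ _ _)/wrap[].
- move=> x; have [i /= /DM iM Oi] : cover [set` D] O (val (pt x)) by apply: KD; exact/set_mem/valP.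
  by exists (Ordinal iM).
- by move=> i; rewrite (leq_trans _ m0m)// (leq_bigmax i).
- move=> i x y [u /= Uu]; rewrite -ball_normE/= => ux [v /= Uv]; rewrite -ball_normE/= => vy.
  have [eta0 h2 _] := hk i; have [th0 the hf] := hth i.
  have := h2 _ _ Uv Uu; rewrite /gp opp_row_mx add_row_mx -!raddfN -raddfD => h.
  split.
    have : `|val v - val u| + 2 * eta i <= 2 ^- k i.
      apply: le_trans h; rewrite lerD2r (le_trans (norm_le_enorm _))//.
      exact: enorm_row_mx_gel.
    have -> : val y - val x = (val v - val u) + (val u - val x) - (val v - val y).
      by apply/rowP => j; rewrite !mxE; ring.
    have := ler_normB ((val v - val u) + (val u - val x)) (val v - val y).
    have := ler_normD (val v - val u) (val u - val x).
    by lra.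
  have : `|f v - f u| + 2 * eta i <= 2 ^- k i.
    by apply: le_trans h; rewrite lerD2r; exact: enorm_row_mx_ger.
  have := hf _ _ ux; have := hf _ _ vy.
  have -> : f y - f x = (f v - f u) + (f u - f x) - (f v - f y) by ring.
  have := ler_normB ((f v - f u) + (f u - f x)) (f v - f y).
  have := ler_normD (f v - f u) (f u - f x).
  by lra.
apply/negP; rewrite -ltNge -lte_fin -sumEFin.
apply: (@le_lt_trans _ _ ((4 `^ s + 1) * eps)%:E).
  apply: (@le_trans _ _ (\sum_(i < M) ((4 `^ s)%:E * diam_pow s' (U i) +
      (eps * 2 ^- i.+1)%:E))%E).
    by apply: lee_sum => i _; have [] := hk i.
  rewrite big_split/= -ge0_sume_distrr; last by move=> i _; exact: diam_pow_ge0.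
  rewrite mulrDl mul1r EFinD EFinM leeD//.
    rewrite lee_wpmul2l ?lee_fin ?powR_ge0//; apply: le_trans sU.
    rewrite -(big_mkord xpredT (fun i => diam_pow s' (U i))).
    by apply: nneseries_lim_ge => i _ _; exact: diam_pow_ge0.
  rewrite sumEFin lee_fin -mulr_sumr -[leRHS]mulr1 ler_wpM2l ?(ltW e0)//.
  exact: sum_half.
rewrite lte_fin /eps mulrC -mulrA -ltr_pdivlMl ?invr_gt0// mulVf ?invr_eq0 ?gt_eqF//.
by rewrite invfM -mulrA mulVf ?gt_eqF// mulr1 invf_lt1// ltr1n.
Qed.

End energy.

(** * Measurability and averages *)

(** Open sets of R^N are countable unions of rational boxes. *)
Lemma measurable_open_rV (R : realType) (N : nat) disp (T : measurableType disp)
    (X : 'I_N -> T -> R) (V : set 'rV[R]_N) :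
  (forall k, measurable_fun setT (X k)) -> open V ->
  measurable [set t | V (\row_k X k t)].
Proof.
move=> mX oV.
pose box (p : {ffun 'I_N -> rat} * nat) : set 'rV[R]_N :=
  [set v | forall k, `|v ord0 k - ratr (p.1 k)| < p.2.+1%:R^-1].
pose F (p : {ffun 'I_N -> rat} * nat) : set T :=
  if `[< box p `<=` V >] then \bigcap_(k in [set: 'I_N]) [set t | `|X k t - ratr (p.1 k)| < p.2.+1%:R^-1]
  else set0.
have -> : [set t | V (\row_k X k t)] = \bigcup_p F p.
  apply/seteqP; split=> [t Vt|t [p _]].
    have /nbhs_ballP[e /= e0 eV] : nbhs (\row_k X k t) V by exact: open_nbhs_nbhs.
    pose n := Num.bound (2 / e).
    have ne : n.+1%:R^-1 < e / 2.
      rewrite -[ltRHS]invrK ltf_pV2 ?posrE ?invr_gt0 ?divr_gt0// invf_div.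
      rewrite (lt_trans (archi_boundP _)) ?ltr_nat//.
      by rewrite divr_ge0// ltW.
    have ne0 : 0 < n.+1%:R^-1 :> R by rewrite invr_gt0.
    have [a aE] : exists a : R, a = n.+1%:R^-1 by eexists.
    rewrite -aE in ne ne0.
    have /choice[q hq] : forall k, exists q : rat, `|X k t - ratr q| < a.
      move=> k; have /rat_in_itvoo[q] : X k t - a < X k t + a by lra.
      rewrite in_itv/= => /andP[h1 h2]; exists q.
      by rewrite ltr_norml; apply/andP; split; lra.
    exists ([ffun k => q k], n) => //; rewrite /F ifT.
      by move=> k _ /=; rewrite ffunE -aE; exact: hq.
    apply/asboolP => v hv; apply: eV; rewrite -ball_normE/=.
    apply: (@le_lt_trans _ _ (a + a)); last by lra.
    rewrite [leLHS]/Num.norm/= mx_normrE; apply: bigmax_le; first by rewrite addr_ge0// ltW.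
    move=> [i k] _ /=; rewrite (ord1 i) !mxE.
    have := hv k; rewrite /= ffunE -aE => h1; have := hq k => h2.
    have -> : X k t - v ord0 k = (X k t - ratr (q k)) - (v ord0 k - ratr (q k)) by ring.
    by rewrite (le_trans (ler_normB _ _))// lerD// ltW.
  rewrite /F; case: asboolP => // hV h.
  by apply: hV => k; rewrite mxE; exact: h.
apply: countable_bigcupT_measurable => // p; rewrite /F; case: ifP => // _.
apply: fin_bigcap_measurable => // k _.
rewrite (_ : [set t | _] = (fun t => `|X k t - ratr (p.1 k)|) @^-1` `]-oo, p.2.+1%:R^-1[); last first.
  by apply/seteqP; split=> t /=; rewrite in_itv.
rewrite -[X in measurable X]setTI.
by apply: measurableT_comp => //; exact: measurable_funB.
Qed.

Lemma markov_sum (R : realType) disp (T : measurableType disp) (P : probability T R)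
    (I : finType) (c : I -> R) (S : I -> set T) (A C : R) :
  0 < A -> (forall i, 0 <= c i) -> (forall i, measurable (S i)) ->
  \sum_i c i * fine (P (S i)) <= C ->
  (P [set t | (A < \sum_i c i * \1_(S i) t)%R] <= (C / A)%:E)%E.
Proof.
move=> A0 c0 mS hC; pose f t := \sum_i c i * \1_(S i) t.
have mf : measurable_fun setT f.
  apply: measurable_sum => i; apply: measurable_funM => //; exact: measurable_indic.
have f0 t : 0 <= f t by apply: sumr_ge0 => i _; rewrite mulr_ge0.
set B := [set t | _].
have mB : measurable B.
  rewrite (_ : B = f @^-1` `]A, +oo[); last first.
    by apply/seteqP; split=> t /=; rewrite in_itv/= andbT.
  by rewrite -[X in measurable X]setTI; exact: mf.
have If : (\int[P]_t (f t)%:E <= C%:E)%E.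
  under eq_integral do rewrite -sumEFin.
  rewrite ge0_integral_sum//; last 2 first.
    move=> i; apply/measurable_EFinP; apply: measurable_funM => //; exact: measurable_indic.
    by move=> i t _; rewrite lee_fin mulr_ge0.
  apply: le_trans (_ : (\sum_i (c i * fine (P (S i)))%:E <= _)%E); last first.
    by rewrite sumEFin lee_fin.
  apply: lee_sum => i _; under eq_integral do rewrite EFinM.
  rewrite ge0_integralZl//; last 2 first.
    by apply/measurable_EFinP; exact: measurable_indic.
    by rewrite lee_fin.
  by rewrite integral_indic// setIT EFinM fineK// fin_num_measure.
have : (A%:E * P B <= \int[P]_t (f t)%:E)%E.
  rewrite -(setIT B) -integral_indic// -ge0_integralZl//; last 2 first.
    by apply/measurable_EFinP; exact: measurable_indic.
    by rewrite lee_fin ltW.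
  apply: ge0_le_integral => //.
  - by move=> t _; rewrite mule_ge0 ?lee_fin// ltW.
  - by apply/measurable_EFinP; exact: measurable_funM.
  - by apply/measurable_EFinP.
  - move=> t _; rewrite -EFinM lee_fin indicE.
    by case: (boolP (t \in B)) => [/set_mem/ltW|_]; rewrite ?mulr1// mulr0.
move=> /le_trans/(_ If); rewrite -lee_pdivlMl//.
by rewrite -EFinM mulrC.
Qed.

Lemma measure_liminf_le (R : realType) disp (T : measurableType disp) (P : probability T R)
    (F : nat -> set T) (c : R) : (forall m, measurable (F m)) ->
  (forall m, (P (F m) <= c%:E)%E) ->
  (P (\bigcup_m0 \bigcap_(m in [set m | (m0 <= m)%N]) F m) <= c%:E)%E.
Proof.
move=> mF Fc; pose G m0 := \bigcap_(m in [set m | (m0 <= m)%N]) F m.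
have mG m0 : measurable (G m0) by apply: bigcap_measurableType => m _.
have nG : nondecreasing_seq G.
  move=> i j ij; apply/subsetPset => t ht m /= jm; apply: ht => /=.
  exact: leq_trans jm.
have mU : measurable (\bigcup_m0 G m0) by exact: bigcupT_measurable.
have cv := nondecreasing_cvg_mu (mu := P) mG mU nG.
rewrite -(cvg_lim _ cv)//; apply: lime_le; first by apply/cvg_ex; eexists; exact: cv.
near=> m0; apply: le_trans (Fc m0); apply: le_measure; rewrite ?inE//.
by move=> t; apply => /=.
Unshelve. all: end_near. Qed.

(** * Snowflake coordinates as Holder functions *)

Lemma norm_coord_max (R : realType) d (x : 'rV[R]_d) : (0 < d)%N ->
  exists i, `|x| = `|x ord0 i|.
Proof.
move=> d0; exists [arg max_(i > Ordinal d0) `|x ord0 i|]%O.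
case: arg_maxP => // i _ hi; apply/eqP; rewrite eq_le coord_le_norm andbT.
by apply: norm_le_coord => // j; exact: hi.
Qed.

Section holder_functions.
Context {R : realType} {d : nat} (alpha : R) (K : set 'rV[R]_d).
Context (alpha_gt0 : 0 < alpha) (cK : compact K).
Local Notation H := (holder_space alpha_gt0 cK).

Lemma holder_evalD (f g : H) x : (f + g) x = f x + g x.
Proof. by []. Qed.

Lemma holder_eval_lincomb (f : H) N (a : 'I_N -> R) (g : 'I_N -> H) x :
  (f + \sum_k a k *: g k) x = f x + \sum_k a k * g k x.
Proof.
rewrite holder_evalD; congr (_ + _).
by elim/big_rec2: _ => // k u v _ <-.
Qed.

(** The snowflake coordinates of every coordinate of R^d, rescaled so that the projections of
K have length at most 1. *)
Lemma holder_snowflake : (0 < d)%N -> alpha < 1 ->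
  exists (N : nat) (g : 'I_N -> H) (c : R), 0 < c /\
    forall x y : K, exists k, c * `|val x - val y| `^ alpha <= `|g k x - g k y|.
Proof.
move=> d0 al1; have [J [phi [c [C [c0 C0 hC hc]]]]] := snowflake_embedding alpha_gt0 al1.
have [M M0 KM] := compact_rV_bounded cK.
pose W : R := 2 * M; have W0 : 0 < W by rewrite mulr_gt0.
have Wi : 0 <= W^-1 by rewrite invr_ge0 ltW.
pose G (p : 'I_d * J) (x : K) : R := phi p.2 (val x ord0 p.1 / W).
have GB (i : 'I_d) (x y : K) : val x ord0 i / W - val y ord0 i / W = (val x - val y) ord0 i / W.
  by rewrite !mxE mulrBl.
have GH p : G p \in is_holder alpha K.
  apply/asboolP; exists (C * W^-1 `^ alpha) => x y.
  rewrite (le_trans (hC _ _ _))// GB normrM (ger0_norm Wi).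
  rewrite -mulrA ler_wpM2l// mulrC powRM// ler_wpM2l ?powR_ge0//.
  apply: ge0_ler_powR; rewrite ?nnegrE ?(ltW alpha_gt0) ?enorm_ge0//.
  exact: coord_le_enorm.
exists #|{: 'I_d * J}|, (fun k => HolderFun alpha_gt0 cK (GH (enum_val k))), (c * W^-1 `^ alpha).
split; first by rewrite mulr_gt0// powR_gt0// invr_gt0.
move=> x y; have [i hi] := norm_coord_max (val x - val y) d0.
have [|j hj] := hc (val x ord0 i / W) (val y ord0 i / W).
  rewrite GB normrM -hi (ger0_norm Wi).
  rewrite ler_pdivrMr// mul1r (le_trans (ler_normB _ _))// /W mulrDl mul1r.
  by apply: lerD; apply: KM; exact/set_mem/valP.
exists (enum_rank (i, j)); rewrite /= enum_rankK.
apply: le_trans hj; rewrite GB normrM -hi -mulrA ler_wpM2l ?(ltW c0)//.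
by rewrite (ger0_norm Wi) powRM// mulrC.
Qed.

Lemma open_eval_increment (x y : K) (r : R) : open [set h : H | `|h y - h x| < r].
Proof.
rewrite openE => h0 /= lt; apply/nbhs_ballP.
pose e := (r - `|h0 y - h0 x|) / 2; have e0 : 0 < e by rewrite /e; lra.
exists e => //= h; rewrite -ball_normE/= holder_normE => hh.
have h1 := le_lt_trans (holder_norm_ge (h0 - h) x) hh.
have h2 := le_lt_trans (holder_norm_ge (h0 - h) y) hh.
have {}h1 : `|h0 x - h x| < e := h1; have {}h2 : `|h0 y - h y| < e := h2.
have -> : h y - h x = (h0 y - h0 x) + (h0 x - h x) - (h0 y - h y) by ring.
have := ler_normB ((h0 y - h0 x) + (h0 x - h x)) (h0 y - h y).
have := ler_normD (h0 y - h0 x) (h0 x - h x).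
by move: h1 h2; rewrite /e; lra.
Qed.

Lemma continuous_lincomb N (f : H) (g : 'I_N -> H) :
  continuous (fun v : 'rV[R]_N => f + \sum_k v ord0 k *: g k).
Proof.
move=> v; apply: (@cvgD _ _ _ (nbhs v) _ (fun=> f) _ f); first exact: cvg_cst.
elim: (index_enum _) => [|k l IH].
  by rewrite big_nil; under eq_fun do rewrite big_nil; exact: cvg_cst.
rewrite big_cons; under eq_fun do rewrite big_cons.
by apply: (@cvgD _ _ _ (nbhs v)) => //; apply: (@cvgZr_tmp _ _ _ (nbhs v)); exact: (@coord_continuous _ _ _ ord0 k v).
Qed.

Lemma holder_uniform_continuous (f : H) (eta : R) : 0 < eta ->
  exists2 theta : R, 0 < theta &
    forall x y : K, `|val x - val y| < theta -> `|f x - f y| < eta.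
Proof.
move=> eta0; have [C0 hC] : exists C0 : R, forall x y : K,
    `|f x - f y| <= C0 * enorm (val x - val y) `^ alpha by exact/asboolP/(holder_valP f).
pose C := `|C0| + 1; have Cp : 0 < C by rewrite ltr_wpDl.
pose D : R := Num.sqrt d%:R + 1; have Dp : 0 < D by rewrite ltr_wpDl ?sqrtr_ge0.
pose th := (eta / C) `^ alpha^-1; have thp : 0 < th by rewrite powR_gt0 ?divr_gt0.
exists (th / D); first by rewrite divr_gt0.
move=> x y xy; rewrite (le_lt_trans (hC _ _))//.
have ed : enorm (val x - val y) < th.
  rewrite (le_lt_trans (enorm_le (lexx _)))// -mulr_natr sqrtrM ?sqr_ge0// sqrtr_sqr normr_id.
  rewrite ltr_pdivlMr// in xy; apply: le_lt_trans xy.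
  by rewrite ler_wpM2l// lerDl.
apply: (@le_lt_trans _ _ (`|C0| * enorm (val x - val y) `^ alpha)).
  by rewrite ler_wpM2r ?powR_ge0// ler_norm.
apply: (@le_lt_trans _ _ (C * enorm (val x - val y) `^ alpha)).
  by rewrite ler_wpM2r ?powR_ge0// lerDl.
rewrite -ltr_pdivlMl// mulrC.
have -> : eta / C = th `^ alpha.
  by rewrite /th -powRrM mulVf ?gt_eqF// powRr1// divr_ge0 ?ltW.
by apply: gt0_ltr_powR; rewrite ?nnegrE ?enorm_ge0 ?(ltW thp).
Qed.

End holder_functions.

Lemma dyadic_powR (R : realType) (s : R) n : (2 ^- n) `^ s = (2^-1 `^ s) ^+ n.
Proof.
by rewrite -powR_mulrn ?powR_ge0// -powRrM mulrC powRrM powR_mulrn ?invr_ge0// exprVn.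
Qed.

Lemma half_powR_itv (R : realType) (s : R) : 0 < s -> 0 < (2^-1 : R) `^ s < 1.
Proof.
move=> s0; have h0 : 0 < (2^-1 : R) by rewrite invr_gt0.
rewrite powR_gt0//= [X in _ < X](_ : 1 = 1 `^ s); last by rewrite powR1.
by apply: gt0_ltr_powR; rewrite ?nnegrE ?invr_ge0// invf_lt1// ltr1n.
Qed.

Lemma dyadic_le (R : realType) i j : (i <= j)%N -> 2 ^- j <= 2 ^- i :> R.
Proof. by move=> ij; rewrite lef_pV2 ?posrE ?exprn_gt0// ler_eXn2l// ltr1n. Qed.

(** * The average energy *)

Section energy_sum.
Context {R : realType} (X : finType) (rho : X -> X -> R) (mu : X -> R).
Context (q : nat -> X -> X -> R) (C1 B alpha beta sigma s : R) (m n : nat).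
Let tau := sigma - alpha * beta.
Let eta := beta + tau - s.
Context (mu0 : forall x, 0 <= mu x) (mu1 : \sum_x mu x = 1) (C10 : 0 <= C1)
  (ball : forall x j, (j <= n)%N -> \sum_(y | rho x y < 2 ^- j) mu y <= C1 * (2 ^- j) `^ sigma)
  (q01 : forall k x y, 0 <= q k x y <= 1)
  (qB : forall k x y, 0 < rho x y -> q k x y <= B * 2 ^- k / rho x y `^ alpha)
  (B0 : 0 < B) (al0 : 0 < alpha) (be0 : 0 < beta) (be1 : beta <= 1)
  (tau0 : 0 < tau) (eta0 : 0 < eta)
  (resol : m.+1%:R * (2 ^+ m) `^ s * (2 ^- n) `^ sigma <= 1) (s0 : 0 <= s).

Let Q k j := (B * 2 ^- k * (2 ^+ j.+1) `^ alpha) `^ beta.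

Let Q0 k j : 0 <= Q k j. Proof. exact: powR_ge0. Qed.

Let pointwise k x y : (if rho x y < 2 ^- k then q k x y else 0) <=
  \sum_(k <= j < n) (if rho x y < 2 ^- j then Q k j else 0)
  + (if rho x y < 2 ^- n then 1 else 0).
Proof.
have /andP[qk0 qk1] := q01 k x y.
have sum0 : 0 <= \sum_(k <= j < n) (if rho x y < 2 ^- j then Q k j else 0).
  by apply: sumr_ge0 => j _; case: ifP.
have [small|big] := ltP (rho x y) (2 ^- n).
  by case: ifP => _; lra.
rewrite addr0; case: ifP => // rk.
have ex : exists i, 2 ^- i <= rho x y by exists n.
case: (ex_minnP ex) => -[|j] hj jmin.
  by move: hj; rewrite leNgt (lt_le_trans rk)//; exact: dyadic_le.
have kj : (k <= j)%N.
  by rewrite leqNgt; apply/negP => /(dyadic_le R)/(le_trans)/(_ hj); rewrite leNgt rk.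
have jn : (j < n)%N by exact: jmin.
have rj : rho x y < 2 ^- j.
  by rewrite ltNge; apply/negP => /jmin; rewrite ltnn.
have r0 : 0 < rho x y by rewrite (lt_le_trans _ hj)// invr_gt0 exprn_gt0.
apply: (@le_trans _ _ (Q k j)); last first.
  rewrite (@big_cat_nat _ _ _ j)//=; last exact: ltnW.
  rewrite [X in _ + X]big_ltn// rj addrCA lerDl addr_ge0// sumr_ge0// => i _; by case: ifP.
apply: (@le_trans _ _ (q k x y `^ beta)).
  have [->|qn0] := eqVneq (q k x y) 0; first exact: powR_ge0.
  by apply: ger1_powR => //; rewrite lt_neqAle eq_sym qn0 qk0.
apply: ge0_ler_powR; rewrite ?nnegrE ?(ltW be0)//.
  by rewrite !mulr_ge0 ?powR_ge0 ?(ltW B0) ?invr_ge0 ?exprn_ge0.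
rewrite (le_trans (qB _ r0))// ler_wpM2l ?mulr_ge0 ?(ltW B0) ?invr_ge0 ?exprn_ge0//.
rewrite -powRN -mulN1r powRrM powR_inv1 ?(ltW r0)//.
apply: ge0_ler_powR; rewrite ?nnegrE ?(ltW al0) ?invr_ge0 ?(ltW r0) ?exprn_ge0//.
by rewrite -[leRHS]invrK lef_pV2 ?posrE ?invr_gt0 ?exprn_gt0.
Qed.

Let D0 := (B * 2 `^ alpha) `^ beta / (1 - 2^-1 `^ tau).

Let D00 : 0 <= D0.
Proof.
have /andP[h0 h1] := half_powR_itv tau0.
by rewrite divr_ge0 ?powR_ge0// subr_ge0 ltW.
Qed.

Let Q_sum k : \sum_(k <= j < n) (2 ^- j) `^ sigma * Q k j <= D0 * (2 ^- k) `^ (beta + tau).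
Proof.
have QE j : (2 ^- j) `^ sigma * Q k j =
    (B * 2 `^ alpha) `^ beta * (2 ^- k) `^ beta * (2^-1 `^ tau) ^+ j.
  have e2 : (2 ^+ j.+1) `^ alpha = 2 `^ alpha * (2 ^+ j) `^ alpha.
    by rewrite exprS powRM ?exprn_ge0.
  rewrite -dyadic_powR /Q e2.
  have -> : B * 2 ^- k * (2 `^ alpha * (2 ^+ j) `^ alpha) =
    (B * 2 `^ alpha) * 2 ^- k * (2 ^+ j) `^ alpha by ring.
  rewrite powRM ?mulr_ge0 ?powR_ge0 ?(ltW B0) ?invr_ge0 ?exprn_ge0//.
  rewrite powRM ?mulr_ge0 ?powR_ge0 ?(ltW B0) ?invr_ge0 ?exprn_ge0//.
  rewrite mulrCA; congr (_ * _).
  have p0 : 0 < 2 ^+ j :> R by rewrite exprn_gt0.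
  rewrite -powRrM -(powR_inv1 (ltW p0)) -!powRrM -powRD ?(gt_eqF p0) ?implybT//.
  by congr powR; rewrite /tau; ring.
rewrite (eq_bigr _ (fun j _ => QE j)) -mulr_sumr.
have /andP[h0 h1] := half_powR_itv tau0.
apply: (@le_trans _ _ ((B * 2 `^ alpha) `^ beta * (2 ^- k) `^ beta *
    ((2^-1 `^ tau) ^+ k / (1 - 2^-1 `^ tau)))).
  by rewrite ler_wpM2l ?mulr_ge0 ?powR_ge0//; exact: sum_geo_small.
have p0 : 0 < 2 ^- k :> R by rewrite invr_gt0 exprn_gt0.
rewrite powRD ?(gt_eqF p0) ?implybT// -dyadic_powR /D0 le_eqVlt; apply/orP; left.
by apply/eqP; ring.
Qed.

(** Here q k x y stands for the probability that the increment of the random function between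
x and y is less than 2 ^- k, and rho for the distance. As q <= q ^ beta, the shell where
rho is about 2 ^- j contributes at most mass * (B * 2 ^- k * 2 ^ (j * alpha)) ^ beta, and
the Frostman condition turns the sum over j >= k into (2 ^- k) ^ (beta + tau), where
tau = sigma - alpha * beta > 0. After multiplication by (2 ^+ k) ^ s the sum over k
converges since s < beta + tau. Points closer than the mesh 2 ^- n carry no information:
there q is bounded by 1, at a total cost that resol makes at most C1. *)
Lemma energy_sum_bound :
  \sum_x \sum_y \sum_(k < m.+1)
    (if rho x y < 2 ^- k then mu x * mu y * (2 ^+ k) `^ s * q k x y else 0)
  <= C1 * (D0 / (1 - 2^-1 `^ eta) + 1).
Proof.
set C2 := C1 * _.
have -> : C2 = \sum_x mu x * C2 by rewrite -mulr_suml mu1 mul1r.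
apply: ler_sum => x _; rewrite exchange_big/=.
have row k : (k <= m)%N ->
    \sum_y mu y * (if rho x y < 2 ^- k then q k x y else 0) <=
    C1 * (D0 * (2 ^- k) `^ (beta + tau) + (2 ^- n) `^ sigma).
  move=> km; apply: (@le_trans _ _ (\sum_(k <= j < n) (C1 * (2 ^- j) `^ sigma) * Q k j
      + C1 * (2 ^- n) `^ sigma)); last first.
    rewrite mulrDr lerD2r [leLHS](eq_bigr (fun j => C1 * ((2 ^- j) `^ sigma * Q k j))).
      by rewrite -mulr_sumr ler_wpM2l.
    by move=> j _; rewrite mulrA.
  apply: (@le_trans _ _ (\sum_(k <= j < n) (\sum_(y | rho x y < 2 ^- j) mu y) * Q k j
      + \sum_(y | rho x y < 2 ^- n) mu y)); last first.
    apply: lerD; last exact: ball.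
    rewrite big_nat_cond [leRHS]big_nat_cond; apply: ler_sum => j.
    by rewrite andbT => /andP[_ jn]; rewrite ler_wpM2r// ball// ltnW.
  apply: (@le_trans _ _ (\sum_y mu y * (\sum_(k <= j < n)
      (if rho x y < 2 ^- j then Q k j else 0) + (if rho x y < 2 ^- n then 1 else 0)))).
    by apply: ler_sum => y _; rewrite ler_wpM2l// pointwise.
  rewrite le_eqVlt; apply/orP; left; apply/eqP.
  under eq_bigr do rewrite mulrDr mulr_sumr.
  rewrite big_split/= exchange_big/=; congr (_ + _).
    apply: eq_bigr => j _; rewrite mulr_suml [RHS]big_mkcond/=.
    by apply: eq_bigr => y _; case: ifP; rewrite ?mulr0.
  rewrite [RHS]big_mkcond/=.
  by apply: eq_bigr => y _; case: ifP; rewrite ?mulr0 ?mulr1.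
have -> : \sum_(k < m.+1) \sum_y (if rho x y < 2 ^- k
      then mu x * mu y * (2 ^+ k) `^ s * q k x y else 0) =
    mu x * \sum_(k < m.+1) (2 ^+ k) `^ s *
      \sum_y mu y * (if rho x y < 2 ^- k then q k x y else 0).
  rewrite mulr_sumr; apply: eq_bigr => k _; rewrite !mulr_sumr.
  by apply: eq_bigr => y _; case: ifP => _; ring.
rewrite ler_wpM2l//.
apply: (@le_trans _ _ (\sum_(k < m.+1) (C1 * (D0 * (2^-1 `^ eta) ^+ k) +
    C1 * ((2 ^+ m) `^ s * (2 ^- n) `^ sigma)))).
  apply: ler_sum => k _; have km : (k <= m)%N by rewrite -ltnS.
  apply: (le_trans (ler_wpM2l (powR_ge0 _ _) (row k km))).
  rewrite mulrCA mulrDr mulrDr lerD//; last first.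
    rewrite ler_wpM2l// ler_wpM2r ?powR_ge0//.
    apply: ge0_ler_powR; rewrite ?nnegrE ?exprn_ge0//.
    by rewrite ler_eXn2l// ltr1n.
  rewrite ler_wpM2l// mulrCA ler_wpM2l// -dyadic_powR le_eqVlt; apply/orP; left.
  have p0 : 0 < 2 ^+ k :> R by rewrite exprn_gt0.
  rewrite -(powR_inv1 (ltW p0)) -!powRrM -powRD ?(gt_eqF p0) ?implybT//.
  by apply/eqP; congr powR; rewrite /eta; ring.
rewrite big_split/= -!mulr_sumr /C2 [leRHS]mulrDr lerD//.
  rewrite ler_wpM2l// ler_wpM2l//; have /andP[h0 h1] := half_powR_itv eta0.
  rewrite -(big_mkord xpredT (fun k => (2^-1 `^ eta) ^+ k)).
  by have := sum_geo_small 0 m.+1 h0 h1; rewrite expr0 div1r.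
by rewrite ler_wpM2l// sumr_const card_ord -(mulr_natl _ m.+1) mulrCA mulrA.
Qed.

End energy_sum.

(** * The probe and the theorem *)

Lemma rat_between_ereal (R : realType) (a : R) (b : \bar R) : (a%:E < b)%E ->
  exists q : rat, a < ratr q /\ ((ratr q)%:E < b)%E.
Proof.
case: b => [b| |]//.
  rewrite lte_fin => /rat_in_itvoo[q]; rewrite in_itv/= => /andP[h1 h2].
  by exists q; rewrite lte_fin.
move=> _; have /rat_in_itvoo[q] : a < a + 1 by lra.
by rewrite in_itv/= => /andP[h1 _]; exists q; rewrite ltry.
Qed.

(** The average energy is controlled for s < beta + (sigma - alpha * beta) with sigma < D,
beta <= 1 and alpha * beta < sigma. For s <= 1 the choice beta = s works as soon as
alpha * s < D, for s > 1 the choice beta = 1 as soon as s - 1 + alpha < D. *)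
Lemma choose_exponents (R : realType) (D : \bar R) (alpha s : R) :
  0 < alpha -> alpha < 1 -> 0 < s ->
  (s%:E < Order.min (D / alpha%:E) (D + 1 - alpha%:E))%E ->
  exists sigma beta : R, [/\ 0 < sigma, (sigma%:E < D)%E, 0 < beta <= 1,
    0 < sigma - alpha * beta & 0 < beta + (sigma - alpha * beta) - s].
Proof.
move=> al0 al1 s0; rewrite lt_min => /andP[h1 h2].
have [s1|s1] := leP s 1.
  have /rat_between_ereal[q [q1 q2]] : ((alpha * s)%:E < D)%E.
    by rewrite mulrC EFinM -lte_pdivlMr//; move: h1; rewrite inver gt_eqF.
  have as0 : 0 < alpha * s by rewrite mulr_gt0.
  by exists (ratr q), s; rewrite s0 s1; split=> //; lra.
have /rat_between_ereal[q [q1 q2]] : ((s - 1 + alpha)%:E < D)%E.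
  move: h2; rewrite -addeA -EFinB -lteBlDr//= -EFinB.
  by rewrite (_ : s - (1 - alpha) = s - 1 + alpha)//; ring.
by exists (ratr q), 1; rewrite ltr01 lexx; split=> //; lra.
Qed.

Section probe.
Context {R : realType} {d : nat} (alpha : R) (K : set 'rV[R]_d).
Context (alpha_gt0 : 0 < alpha) (cK : compact K).
Local Notation H := (holder_space alpha_gt0 cK).
Context (N : nat) (g : 'I_N -> H) (c : R).
Context (c0 : 0 < c) (g_snow : forall x y : K,
  exists k, c * `|val x - val y| `^ alpha <= `|g k x - g k y|).
Context (disp : measure_display) (T : measurableType disp) (P : probability T R)
  (X : 'I_N -> T -> R).
Context (mX : forall k, measurable_fun setT (X k))
  (PX : forall (a : R) (b : 'I_N -> R) (e r : R), 0 < e -> 0 <= r ->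
    (exists k, e <= `|b k|) ->
    (P [set t | (`|a + \sum_k b k * X k t| < r)%R] <= (2 * r / e)%:E)%E).

Definition probe (f : H) (t : T) : H := f + \sum_k X k t *: g k.

Lemma probe_eval (f : H) t x : probe f t x = f x + \sum_k X k t * g k x.
Proof. exact: (holder_eval_lincomb f (fun k => X k t)). Qed.

Lemma measurable_probe (f : H) : measurable_fun setT (probe f : T -> borel H).
Proof.
apply: (@measurability _ _ T (borel H) setT (probe f) (@open H)) => // _ [V oV <-]; rewrite setTI.
pose W : set 'rV[R]_N := (fun v : 'rV[R]_N => f + \sum_k v ord0 k *: g k) @^-1` (V : set H).
have -> : probe f @^-1` V = [set t | W (\row_k X k t)].
  have e t : probe f t = f + \sum_k (\row_j X j t : 'rV[R]_N) ord0 k *: g k.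
    by congr (_ + _); apply: eq_bigr => k _; rewrite mxE.
  by apply/seteqP; split=> t; rewrite /W /preimage/= e.
apply: measurable_open_rV => //; apply: open_comp => // v _.
exact: continuous_lincomb.
Qed.

(** Some snowflake coordinate g k has an increment comparable with |y - x| ^ alpha, whatever
the deterministic function f added to the random one. *)
Lemma probe_small_ball (f : H) (x y : K) (r : R) : 0 <= r -> 0 < `|val y - val x| ->
  (P [set t | (`|probe f t y - probe f t x| < r)%R] <=
    (2 / c * r / `|val y - val x| `^ alpha)%:E)%E.
Proof.
move=> r0 xy0; have [k hk] := g_snow y x.
have e0 : 0 < c * `|val y - val x| `^ alpha by rewrite mulr_gt0// powR_gt0.
have := @PX (f y - f x) (fun k => g k y - g k x) _ r e0 r0 (ex_intro _ k hk).
rewrite (_ : 2 * r / _ = 2 / c * r / `|val y - val x| `^ alpha); last first.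
  by rewrite invfM; ring.
apply: le_trans; rewrite le_eqVlt; apply/orP; left; apply/eqP; congr (P _).
apply/seteqP; split=> t; rewrite /mkset !probe_eval => h.
  rewrite (_ : _ + _ = f y + \sum_(k < N) X k t * g k y - (f x + \sum_(k < N) X k t * g k x))//.
  by rewrite opprD addrACA -sumrB; congr (_ + _); apply: eq_bigr => i _; ring.
rewrite (_ : _ - _ = f y - f x + \sum_(k < N) (g k y - g k x) * X k t)//.
by rewrite opprD addrACA -sumrB; congr (_ + _); apply: eq_bigr => i _; ring.
Qed.

Section energy_terms.
Context (Y : finType) (pt : Y -> K) (mu : Y -> R) (s : R) (m : nat).
Context (mu0 : forall x, 0 <= mu x).

Let w (p : Y * Y * 'I_m.+1) : R :=
  if `|val (pt p.1.2) - val (pt p.1.1)| < 2 ^- p.2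
  then mu p.1.1 * mu p.1.2 * (2 ^+ p.2) `^ s else 0.

Let S (p : Y * Y * 'I_m.+1) : set H :=
  [set h | `|h (pt p.1.2) - h (pt p.1.1)| < 2 ^- p.2].

Let w0 p : 0 <= w p.
Proof. by rewrite /w; case: ifP => // _; rewrite mulr_ge0 ?powR_ge0 ?mulr_ge0. Qed.

Let energyE (h : H) : energy pt mu s m h = \sum_p w p * \1_(S p) h.
Proof.
rewrite /energy pair_bigA/= pair_bigA/=; apply: eq_bigr => -[[x y] k] _ /=.
rewrite /w/= indicE; case: ifPn => [/andP[-> h1]|].
  by rewrite mem_set ?mulr1.
rewrite negb_and => /orP[/negbTE ->|h1]; first by rewrite mul0r.
by rewrite memNset ?mulr0// => h2; rewrite /S/= in h2; rewrite h2 in h1.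
Qed.

Lemma measurable_energy_gt (A : R) :
  measurable ([set h : H | A < energy pt mu s m h] : set (borel H)).
Proof.
have mf : measurable_fun [set: borel H] (fun h : borel H => \sum_p w p * \1_(S p) h).
  apply: measurable_sum => p; apply: measurable_funM => //; apply: measurable_indic.
  apply: sub_sigma_algebra; exact: open_eval_increment.
rewrite (_ : mkset _ = (fun h : borel H => \sum_p w p * \1_(S p) h) @^-1` `]A, +oo[).
  by rewrite -[X in measurable X]setTI; exact: mf.
by apply/seteqP; split=> h /=; rewrite in_itv/= andbT energyE.
Qed.

Lemma probe_energy_markov (f : H) (n : nat) (sigma beta C1 A : R) :
  \sum_x mu x = 1 -> 0 <= C1 ->
  (forall x j, (j <= n)%N ->
    \sum_(y | `|val (pt y) - val (pt x)| < 2 ^- j) mu y <= C1 * (2 ^- j) `^ sigma) ->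
  0 < beta <= 1 -> 0 < sigma - alpha * beta -> 0 < beta + (sigma - alpha * beta) - s ->
  m.+1%:R * (2 ^+ m) `^ s * (2 ^- n) `^ sigma <= 1 -> 0 <= s -> 0 < A ->
  (P [set t | (A < energy pt mu s m (probe f t))%R] <=
   (C1 * ((2 / c * 2 `^ alpha) `^ beta / (1 - 2^-1 `^ (sigma - alpha * beta)) /
     (1 - 2^-1 `^ (beta + (sigma - alpha * beta) - s)) + 1) / A)%:E)%E.
Proof.
move=> mu1 C10 ball /andP[be0 be1] tau0 eta0 resol s0 A0.
have mS p : measurable [set t | S p (probe f t)].
  rewrite -[X in measurable X]setTI; apply: measurable_probe => //.
  apply: sub_sigma_algebra; exact: open_eval_increment.
rewrite (_ : mkset _ = [set t | A < \sum_p w p * \1_([set t | S p (probe f t)]) t]); last first.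
  have e t : energy pt mu s m (probe f t) =
      \sum_p w p * \1_([set t | S p (probe f t)]) t.
    by rewrite energyE; apply: eq_bigr => p _; rewrite !indicE.
  by apply/seteqP; split=> t; rewrite /mkset e.
apply: markov_sum => //.
pose q k x y := fine (P [set t | `|probe f t (pt y) - probe f t (pt x)| < 2 ^- k]).
have mq (k : nat) x y : measurable [set t | `|probe f t (pt y) - probe f t (pt x)| < 2 ^- k].
  rewrite -[X in measurable X]setTI.
  apply: (@measurable_probe f _ [set h : H | `|h (pt y) - h (pt x)| < 2 ^- k]) => //.
  apply: sub_sigma_algebra; exact: open_eval_increment.
have q01 k x y : 0 <= q k x y <= 1.
  have mqk := mq k x y; rewrite /q fine_ge0//= -lee_fin fineK; last exact: fin_num_measure.
  exact: probability_le1.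
have cc : 0 < 2 / c by rewrite divr_gt0.
have qB (k : nat) (x y : Y) : 0 < `|val (pt y) - val (pt x)| ->
    q k x y <= 2 / c * 2 ^- k / `|val (pt y) - val (pt x)| `^ alpha.
  move=> xy; have mqk := mq k x y; rewrite -lee_fin /q fineK; last exact: fin_num_measure.
  by apply: probe_small_ball => //; rewrite invr_ge0 exprn_ge0.
have := @energy_sum_bound R Y (fun x y => `|val (pt y) - val (pt x)|) mu q C1 (2 / c)
  alpha beta sigma s m n mu0 mu1 C10 ball q01 qB cc alpha_gt0 be0 be1 tau0 eta0 resol s0.
apply: le_trans; rewrite pair_bigA/= pair_bigA/= le_eqVlt; apply/orP; left; apply/eqP.
apply: eq_bigr => -[[x y] k] _ /=; rewrite /w/=; case: ifP => _; last by rewrite mul0r.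
by [].
Qed.

End energy_terms.

(** B is the set of functions whose energies tend to infinity with m. Their averages over the
probe are bounded, so Markov's inequality and measure_liminf_le make B negligible along
every translate of the probe; off B the energies stay bounded along a subsequence, which is all
that hausdorff_pos_of_energy requires. *)
Lemma null_small_energy (s : R) : 0 < s -> alpha < 1 ->
  (s%:E < Order.min (hausdorff_dim K / alpha%:E) (hausdorff_dim K + 1 - alpha%:E))%E ->
  exists B : set H, [/\ measurable (B : set (borel H)),
    forall f : H, P [set t | B (probe f t)] = 0%E &
    forall f : H, ~ B f -> forall s' : R, 0 <= s' -> s' <= s ->
      hausdorff_measure s' (graph f) <> 0%E].
Proof.
move=> s0 al1 /(choose_exponents alpha_gt0 al1 s0)[sigma [beta [sg0 sgD be01 tau0 eta0]]].
have Ksg : hausdorff_measure sigma K <> 0%E.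
  move=> K0; move: sgD; rewrite ltNge => /negP; apply.
  by apply: ereal_inf_lbound; exists sigma => //; split=> //; exact: ltW.
have [C1 C10 frost] := discrete_frostman cK sg0 Ksg.
pose good (m : nat) (D : {Y : finType & ((Y -> K) * (Y -> R))%type}) :=
  let pt := (projT2 D).1 in let mu := (projT2 D).2 in
  [/\ forall x, 0 <= mu x, \sum_x mu x = 1 & exists2 n,
     m.+1%:R * (2 ^+ m) `^ s * (2 ^- n) `^ sigma <= 1 &
     forall x j, (j <= n)%N ->
      \sum_(y | `|val (pt y) - val (pt x)| < 2 ^- j) mu y <= C1 * (2 ^- j) `^ sigma].
have /choice[D goodD] : forall m, exists D, good m D.
  move=> m; have e0 : 0 < (m.+1%:R * (2 ^+ m) `^ s)^-1.
    by rewrite invr_gt0 mulr_gt0 ?powR_gt0 ?exprn_gt0.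
  have [n /(_ n (leqnn _)) hn] := exp2_small sg0 e0.
  have [Y [pt [mu [Kpt mu0 mu1 hball]]]] := frost n.
  exists (existT _ Y ((fun x => SigSub (mem_set (Kpt x)) : K), mu)); split=> //=.
  by exists n => //; rewrite mulrC -ler_pdivlMr ?div1r// -invr_gt0.
pose En (m : nat) (h : K -> R) : R := energy (projT2 (D m)).1 (projT2 (D m)).2 s m h.
pose F (A m : nat) : set H := [set h | A.+1%:R < En m h].
pose B : set H := \bigcap_A \bigcup_m0 \bigcap_(m in [set m | (m0 <= m)%N]) F A m.
have mF A m : measurable (F A m : set (borel H)).
  exact: measurable_energy_gt.
exists B; split.
- apply: bigcapT_measurable => A; apply: bigcupT_measurable => m0.
  by apply: bigcap_measurableType => m _; exact: mF.
- move=> f; set C2 := C1 * ((2 / c * 2 `^ alpha) `^ beta / (1 - 2^-1 `^ (sigma - alpha * beta)) /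
     (1 - 2^-1 `^ (beta + (sigma - alpha * beta) - s)) + 1).
  have mFt A m : measurable [set t | F A m (probe f t)].
    by rewrite -[X in measurable X]setTI; apply: measurable_probe => //; exact: mF.
  have hF A m : (P [set t | F A m (probe f t)] <= (C2 / A.+1%:R)%:E)%E.
    have [mu0 mu1 [n resol hball]] := goodD m.
    by apply: (probe_energy_markov _ _ mu1 _ hball) => //; exact: ltW.
  have hB A : (P [set t | B (probe f t)] <= (C2 / A.+1%:R)%:E)%E.
    apply: le_trans (measure_liminf_le (mFt A) (hF A)).
    apply: le_measure; rewrite ?inE.
    + rewrite -[X in measurable X]setTI; apply: measurable_probe => //.
      apply: bigcapT_measurable => A'; apply: bigcupT_measurable => m0.
      by apply: bigcap_measurableType => m _; exact: mF.
    + apply: bigcupT_measurable => m0.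
      by apply: bigcap_measurableType => m _; exact: mFt.
    + by move=> t /(_ A I)[m0 _ hm0]; exists m0.
  apply/eqP; rewrite eq_le measure_ge0 andbT; apply/lee_addgt0Pr => e e0; rewrite add0e.
  have [A hA] : exists A : nat, C2 / A.+1%:R <= e.
    exists (Num.bound (`|C2| / e)); rewrite ler_pdivrMr// mulrC -ler_pdivrMr//.
    rewrite (@le_trans _ _ (`|C2| / e))//; first by rewrite ler_wpM2r ?invr_ge0 ?(ltW e0)// ler_norm.
    have h0 : 0 <= `|C2| / e by rewrite divr_ge0// ltW.
    by rewrite (le_trans (ltW (archi_boundP h0)))// ler_nat.
  by apply: (le_trans (hB A)); rewrite lee_fin.
- move=> f nB s' s'0 s's.
  have [A hA] : exists A : nat, forall m0, exists2 m, (m0 <= m)%N & En m f <= A.+1%:R.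
    apply: contrapT => /forallNP h; apply: nB => A _.
    have /existsNP[m0 hm0] := h A; exists m0 => // m /= m0m.
    by rewrite /F/= ltNge; apply/negP => le; apply: hm0; exists m.
  apply: (@hausdorff_pos_of_energy R d K s s' A.+1%:R f cK s0 s'0 s's) => //.
  + by move=> eta; exact: holder_uniform_continuous.
  + move=> m0; have [m m0m EA] := hA m0; exists m; split=> //.
    exists (projT1 (D m)), (projT2 (D m)).1, (projT2 (D m)).2.
    by have [mu0 mu1 _] := goodD m.
Qed.

End probe.

(** The preimage under Phi of the translate of a set by x is the set of parameters t with
Phi t - x in the set, so translates are covered by letting x range over E. *)
Lemma haar_null_of_probe (R : realType) (E : completeNormedModType R) (B : nat -> set E)
    disp (T : measurableType disp) (P : probability T R) (Phi : T -> E) (C : set E) :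
  measurable_fun setT (Phi : T -> borel E) -> compact C -> (forall t, C (Phi t)) ->
  (forall n, measurable (B n : set (borel E))) ->
  (forall n x, P [set t | B n (x + Phi t)] = 0%E) ->
  (forall x, measurable_fun setT ((fun t => x + Phi t) : T -> borel E)) ->
  haar_null_borel (\bigcup_n B n).
Proof.
move=> mPhi cC PhiC mB PB mPhix; split; first exact: bigcupT_measurable.
pose Y : {mfun T >-> borel E} := HB.pack (Phi : T -> borel E)
  (isMeasurableFun.Build _ _ _ _ (Phi : T -> borel E) mPhi).
exists (distribution P Y); split.
  exists C => //; change (P (Phi @^-1` (~` C)) = 0%E).
  rewrite (_ : _ @^-1` _ = set0) ?measure0//.
  by apply/seteqP; split=> t //=; apply; exact: PhiC.
move=> x; change (P (Phi @^-1` [set x + a | a in \bigcup_n B n]) = 0%E).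
rewrite (_ : _ @^-1` _ = \bigcup_n [set t | B n (- x + Phi t)]); last first.
  apply/seteqP; split=> t /=.
    by move=> [a [n _ Ba] xa]; exists n => //=; rewrite -xa addKr.
  by move=> [n _ /= Bn]; exists (- x + Phi t); [exists n|rewrite addNKr].
have mBt n : measurable [set t | B n (- x + Phi t)].
  by rewrite -[X in measurable X]setTI; apply: (mPhix (- x)) => //; exact: mB.
apply/eqP; rewrite eq_le measure_ge0 andbT.
apply: (le_trans (measure_sigma_subadditive P mBt (bigcupT_measurable _ mBt) (@subset_refl _ _))).
by rewrite eseries0// => n _ _; exact: PB.
Qed.

Theorem theorem5 (R : realType) (d : nat) (alpha : R) (K : set 'rV[R]_d)
    (d_gt0 : (0 < d)%N) (alpha_gt0 : 0 < alpha) (alpha_lt1 : alpha < 1)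
    (cK : compact K) (dimK_gt0 : (0 < hausdorff_dim K)%E) :
  prevalent [set f : holder_space alpha_gt0 cK |
    hausdorff_dim (graph f) =
      Order.min (hausdorff_dim K / alpha%:E)%E
                (hausdorff_dim K + 1 - alpha%:E)%E].
Proof.
set tau := Order.min _ _; set H := holder_space alpha_gt0 cK.
have [N [g [c [c0 g_snow]]]] := @holder_snowflake R d alpha K alpha_gt0 cK d_gt0 alpha_lt1.
have [disp [T [P [X [mX X01 PX]]]]] := cube_probability R N.
(* the exponents below tau are exhausted by the rational ones, enumerated by rt *)
pose rt (n : nat) : R := ratr (odflt 0 (unpickle n : option rat)).
have /choice[B hB] : forall n, exists B : set H, [/\ measurable (B : set (borel H)),
    forall f : H, P [set t | B (probe g X f t)] = 0%E &
    0 < rt n -> ((rt n)%:E < tau)%E -> forall f : H, ~ B f ->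
      forall s' : R, 0 <= s' -> s' <= rt n -> hausdorff_measure s' (graph f) <> 0%E].
  move=> n; have [s0|s0] := ltP 0 (rt n); last first.
    by exists set0; split=> // f; rewrite (_ : [set t | _] = set0)// measure0.
  have [st|st] := ltP (rt n)%:E tau; last first.
    by exists set0; split=> // f; rewrite (_ : [set t | _] = set0)// measure0.
  have [B [B1 B2 B3]] := null_small_energy c0 g_snow mX PX s0 alpha_lt1 st.
  by exists B; split.
exists (\bigcup_n B n).
  pose cube := [set v : 'rV[R]_N | forall k, `[0, 1]%classic (v ord0 k)].
  pose L (v : 'rV[R]_N) : H := 0 + \sum_k v ord0 k *: g k.
  have probeE f t : probe g X f t = f + probe g X 0 t by rewrite /probe add0r.
  apply: (@haar_null_of_probe R H B disp T P (probe g X 0) (L @` cube)).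
  - exact: measurable_probe.
  - apply: continuous_compact; last exact: (@rV_compact R N (fun=> `[0, 1]%classic) (fun=> @segment_compact R 0 1)).
    by apply: continuous_subspaceT => v; exact: continuous_lincomb.
  - move=> t; exists (\row_k X k t).
      by move=> k /=; rewrite mxE in_itv/=; exact: X01.
    by rewrite /L /probe; congr (_ + _); apply: eq_bigr => k _; rewrite mxE.
  - by move=> n; have [] := hB n.
  - move=> n x; have [_ h _] := hB n; rewrite -[RHS](h x); congr (P _).
    by apply/seteqP; split=> t; rewrite /mkset (probeE x).
  - move=> x; rewrite (_ : (fun t => _) = probe g X x); first exact: measurable_probe.
    by apply/funext => t; rewrite (probeE x).
move=> f /= nf; apply: contrapT => nB; apply: nf; apply/eqP; rewrite eq_le.
apply/andP; split.
  have [C hC] : exists C : R, forall x y : K,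
    `|f x - f y| <= C * enorm (val x - val y) `^ alpha by exact/asboolP/(holder_valP f).
  apply: (@hausdorff_dim_graph_le R d alpha K f `|C|) => //.
  by move=> x y; rewrite (le_trans (hC x y))// ler_wpM2r ?powR_ge0// ler_norm.
apply: le_ereal_inf_tmp => _ [s' [s'0 Ks'] <-]; rewrite leNgt; apply/negP.
move=> /rat_between_ereal[q [q1 q2]].
have rq : rt (pickle q) = ratr q by rewrite /rt pickleK.
have [_ _ hq] := hB (pickle q); rewrite rq in hq.
apply: (hq _ q2 f _ s' s'0 (ltW q1) Ks').
  exact: le_lt_trans q1.
by move=> Bf; apply: nB; exists (pickle q).
Qed.
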